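(* Let $\rho_0\ge0$ be a finite Radon measure on $\mathbb{R}$ with total mass $M$. With $m_0,\bar F,\bar\nu,\bar y_*$ as defined in the context, let $$\bar m(x,t):=\begin{cases}\int_{-\infty}^{\bar y_*(x,t)-}\mathrm{d}m_0(\eta) & \text{if }\bar\nu(x,t)=\bar F(\bar y_*(x,t);x,t),\\ \int_{-\infty}^{\bar y_*(x,t)+}\mathrm{d}m_0(\eta) & \text{otherwise,}\end{cases}\qquad (x,t)\in\mathbb{R}\times(0,\infty).$$ Then this is the solution formula of the drift equations $$\bar\rho_t-(\bar\rho\,\bar\Phi_x)_x=0,\qquad \bar\Phi_{xx}=\bar\rho,$$ in the sense that $\bar\rho=\bar m_x$ is a weak solution of them (as defined in the context, with initial data $\rho_0$).
   Context: **Notation.** $m_0(x)=\rho_0((-\infty,x))$; $\mathrm{d}m_0=\rho_0$; $\widetilde m_0(x)=\frac12(m_0(x-)+m_0(x+)-M)$ with $m_0(x\pm)$ one-sided limits. $\int_{-\infty}^{y-}$ means integration over $(-\infty,y)$ and $\int_{-\infty}^{y+}$ over $(-\infty,y]$. For $(x,t)\in\mathbb{R}\times(0,\infty)$, $$\bar F(y;x,t)=\int_{-\infty}^{y-}\big(\eta-t\,\widetilde m_0(\eta)-x\big)\,\mathrm{d}m_0(\eta),$$ $\bar\nu(x,t)=\min_{y\in\mathbb{R}}\bar F(y;x,t)$ (understood as infimum), $\bar S(x,t)=\{y:\exists\,y_n\to y\text{ with }\bar F(y_n;x,t)\to\bar\nu(x,t)\}$, $\bar y_*(x,t)=\inf\{\bar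 S(x,t)\cap\mathrm{spt}\{\rho_0\}\}$. **Weak solution of the drift equations.** Let $\bar m(x,t)\in[0,M]$ be nondecreasing in $x$ with the measure $\bar m_x$ weakly continuous in $t$, and let $\widehat m(x,t)=\frac12(\bar m(x-,t)+\bar m(x+,t)-M)$ (playing the role of $\bar\Phi_x$). Then $\bar\rho=\bar m_x$ is called a weak solution if for any $\varphi\in C_c^\infty(\mathbb{R}\times(0,\infty))$, $$\iint\varphi_t\bar m\,\mathrm{d}x\mathrm{d}t+\iint\varphi\,\widehat m\,\mathrm{d}\bar m\,\mathrm{d}t=0$$ (Lebesgue–Stieltjes integral in $x$), and as $t\to0+$ the measure $\bar\rho=\bar m_x$ converges weakly to $\rho_0$.
   Formalization: The formal theorem additionally assumes the integral defining F̄(y;x,t) converges, i.e. ρ₀ has finite first moment on the left half-line; otherwise F̄ ≡ −∞, ȳ_* = −∞, m̄ ≡ 0 and the initial condition fails. *)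

(* Defs.v *)
From HB Require Import structures.
From mathcomp Require Import all_boot all_order all_algebra.
From mathcomp Require Import all_classical all_reals all_analysis.

Set Implicit Arguments.
Unset Strict Implicit.
Unset Printing Implicit Defensive.

Import Order.TTheory GRing.Theory Num.Theory.
Import numFieldNormedType.Exports.

Local Open Scope classical_set_scope.
Local Open Scope ring_scope.

Section one_sided_limits.
Context {R : realType}.
Implicit Types (f : R -> R) (x M : R).

Definition llim f x : R := lim (f y @[y --> x^'-]).

Definition rlim f x : R := lim (f y @[y --> x^'+]).

Definition field M f x : R := (llim f x + rlim f x - M) / 2.

End one_sided_limits.

Section stieltjes.
Context {R : realType}.
Implicit Types f : R -> R.

Lemma nondecreasing_is_cvg_right f : nondecreasing f ->
  forall x, cvg (f y @[y --> x^'+]).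
Proof.
move=> ndf x; apply: nondecreasing_at_right_is_cvgr.
- by near=> b => y z _ _ /ndf.
- near=> b; exists (f x) => _ [y + <-]; rewrite /= in_itv/= => /andP[xy _].
  exact/ndf/ltW.
Unshelve. all: by end_near. Qed.

Lemma nondecreasing_le_rlim f : nondecreasing f -> forall x, f x <= rlim f x.
Proof.
move=> ndf x; apply: limr_ge; first exact: nondecreasing_is_cvg_right.
by near=> y; apply/ndf/ltW; near: y; exact: nbhs_right_gt.
Unshelve. all: by end_near. Qed.

Lemma nondecreasing_rlim_le f : nondecreasing f ->
  forall x y, x < y -> rlim f x <= f y.
Proof.
move=> ndf x y xy; apply: limr_le; first exact: nondecreasing_is_cvg_right.
by near=> z; apply/ndf/ltW; near: z; exact: nbhs_right_lt.
Unshelve. all: by end_near. Qed.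

Lemma rlim_nondecreasing f : nondecreasing f -> nondecreasing (rlim f).
Proof.
move=> ndf x y; rewrite le_eqVlt => /predU1P[->//|xy].
exact: (le_trans (nondecreasing_rlim_le ndf xy) (nondecreasing_le_rlim ndf y)).
Qed.

Lemma rlim_right_continuous f : nondecreasing f -> right_continuous (rlim f).
Proof.
move=> ndf x; apply/cvgrPdist_le => e e0.
have fx : f y @[y --> x^'+] --> rlim f x by exact: nondecreasing_is_cvg_right.
have /cvgrPdist_le/(_ _ e0) fxe := fx.
have [z [xz fz]] : exists z, x < z /\ `|rlim f x - f z| <= e.
  by apply: (@filter_ex _ x^'+); near=> z; split; near: z;
    [exact: nbhs_right_gt|exact: fxe].
near=> y.
have xy : x <= y by near: y; exact: nbhs_right_ge.
have yz : y < z by near: y; exact: nbhs_right_lt.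
apply: le_trans fz; rewrite !(distrC (rlim f x)).
rewrite !ger0_norm ?subr_ge0 ?(nondecreasing_rlim_le ndf) ?rlim_nondecreasing//.
by rewrite lerB// nondecreasing_rlim_le.
Unshelve. all: by end_near. Qed.

Definition right_regularization f (ndf : nondecreasing f) : cumulative R R :=
  HB.pack_for (cumulative R R) (rlim f)
    (isCumulative.Build R _ R (rlim f)
       (rlim_nondecreasing ndf) (rlim_right_continuous ndf)).

(* The library measure takes a right-continuous argument. A nondecreasing f and
   its right-continuous regularization have the same one-sided limits, hence the
   same Stieltjes measure: ]a, b] gets mass f(b+) - f(a+). The second branch
   only makes the definition total. *)
Definition stieltjes f : {measure set (measurableTypeR R) -> \bar R} :=
  match pselect (nondecreasing f) with
  | left ndf => lebesgue_stieltjes_measure (right_regularization ndf)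
  | right _ => mzero
  end.

End stieltjes.

Section weak_convergence.
Context {R : realType}.
Local Notation measureR := {measure set (measurableTypeR R) -> \bar R}.

(* Test functions are bounded and continuous, so no mass escapes to infinity. *)
Definition weak_cvg_measure (F : set_system R) (nu : R -> measureR)
    (mu : measureR) : Prop :=
  forall psi : R -> R, continuous psi -> bounded_fun psi ->
    \int[nu t]_x psi x @[t --> F] --> \int[mu]_x psi x.

End weak_convergence.

Section test_functions.
Context {R : realType}.
Implicit Types phi : R * R -> R.

(* Points of the plane are pairs (x, t): false is d/dx, true is d/dt. *)
Definition direction (b : bool) : R * R := if b then (0, 1) else (1, 0).

Definition partial phi (b : bool) : R * R -> R := 'D_(direction b) phi.

Definition smooth phi : Prop :=
  forall s : seq bool, let g := foldl partial phi s in
    continuous g /\ forall p b, derivable g p (direction b).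

Definition topological_support phi : set (R * R) :=
  closure [set p | phi p != 0].

(* C_c^oo(R x ]0, +oo[), each element being extended by 0 to the whole plane. *)
Definition test_function phi : Prop :=
  [/\ smooth phi, compact (topological_support phi) &
      topological_support phi `<=` [set p | 0 < p.2]].

End test_functions.

Section drift_equations.
Context {R : realType}.
Variable rho0 : {finite_measure set (measurableTypeR R) -> \bar R}.
Local Notation mu := (@lebesgue_measure R).

Definition mass : R := fine (rho0 setT).

Definition transport_term (m : R -> R -> R) (phi : R * R -> R) (t : R) : R :=
  \int[mu]_x (partial phi true (x, t) * m x t).

Definition drift_term (m : R -> R -> R) (phi : R * R -> R) (t : R) : R :=
  \int[stieltjes (m ^~ t)]_x (phi (x, t) * field mass (m ^~ t) x).

(* The double integrals are iterated. At fixed t > 0 the integrands in x are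
   bounded Borel functions with compact support; integrability in t states that
   the outer integrals exist. *)
Definition weak_solution (m : R -> R -> R) : Prop :=
  [/\ forall x t : R, 0 < t -> 0 <= m x t <= mass,
      forall t : R, 0 < t -> nondecreasing (m ^~ t),
      forall t0 : R, 0 < t0 ->
        weak_cvg_measure (nbhs t0) (fun t => stieltjes (m ^~ t))
          (stieltjes (m ^~ t0)),
      forall phi : R * R -> R, test_function phi ->
        [/\ mu.-integrable `]0, +oo[%classic (EFin \o transport_term m phi),
            mu.-integrable `]0, +oo[%classic (EFin \o drift_term m phi) &
            \int[mu]_(t in `]0, +oo[%classic) transport_term m phi t
            + \int[mu]_(t in `]0, +oo[%classic) drift_term m phi t = 0] &
      weak_cvg_measure (0 : R)^'+ (fun t => stieltjes (m ^~ t)) rho0].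

Definition m0 (x : R) : R := fine (rho0 `]-oo, x[%classic).

Definition mtilde0 : R -> R := field mass m0.

Definition integrandF (x t eta : R) : R := eta - t * mtilde0 eta - x.

Definition Fbar (x t y : R) : R :=
  \int[rho0]_(eta in `]-oo, y[%classic) integrandF x t eta.

(* rho0 is finite, so this amounts to asking that the first moment of rho0 on the left
   half-line be finite. Otherwise the integral is -oo for every y. *)
Definition Fbar_well_defined : Prop :=
  forall x t y : R, 0 < t ->
    rho0.-integrable `]-oo, y[%classic (fun eta => (integrandF x t eta)%:E).

Definition nubar (x t : R) : R := inf (range (Fbar x t)).

Definition Sbar (x t : R) : set R :=
  [set y | exists u : nat -> R,
     u n @[n --> \oo] --> y /\ Fbar x t (u n) @[n --> \oo] --> nubar x t].

Definition spt : set R :=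
  [set x | forall U : set R, open U -> U x -> (0 < rho0 U)%E].

(* If rho0 = 0 this is the infimum of the empty set, 0 by convention; mbar is
   then 0 whatever the value of ystar. *)
Definition ystar (x t : R) : R := inf (Sbar x t `&` spt).

Definition mbar (x t : R) : R :=
  if nubar x t == Fbar x t (ystar x t) then fine (rho0 `]-oo, ystar x t[%classic)
  else fine (rho0 `]-oo, ystar x t]%classic).

End drift_equations.

(* Main.v *)
Require Import Defs.
From HB Require Import structures.
From mathcomp Require Import all_boot all_order all_algebra.
From mathcomp Require Import all_classical all_reals all_analysis.
From mathcomp Require Import measurable_realfun.
From mathcomp Require Import lra ring.

(** Write m0 for the distribution function of rho0, M for its mass, and
    flux w = (w^2 - M w) / 2, so that field M m0 d(m0) = d(flux m0). Then
      Fbar(y; x, t) = A(y) - x m0(y) - t flux(m0(y))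
    is affine in (x, t) for fixed y, and nubar is an infimum of affine
    functions. Since mbar(x, t) is the limit of m0 along a minimizing sequence,
    it yields a supergradient of nubar:
      nubar(x', t') <= nubar(x, t) - (x' - x) mbar(x, t)
                                   - (t' - t) flux(mbar(x, t)),
    also at t = 0 with mbar(x, 0) := m0(x). Everything else follows from this
    inequality. Adding it to the one with the two points exchanged gives
    monotonicity in x and finite speed of propagation M / 2, hence convergence
    of the quantile functions and weak continuity of the measures in t. It also
    gives nubar_x = - mbar and nubar_t = - flux mbar, so that
    E(t) = int phi mbar dx = int phi_x nubar dx has derivative
    int phi_t mbar dx - int phi_x (flux mbar) dx, which integrates to 0; the
    second term is the drift term by the chain rule for the midpoint value. *)

Set Implicit Arguments.
Unset Strict Implicit.
Unset Printing Implicit Defensive.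

Import Order.TTheory GRing.Theory Num.Theory.
Import numFieldNormedType.Exports.

Local Open Scope classical_set_scope.
Local Open Scope ring_scope.

(** * Distribution functions and quantiles *)

(** The infimum in [nubar] need not be attained: [m0] is only left-continuous, so [Fbar] can be
    smaller just to the right of an atom than at the atom. The two branches of [mbar] select the
    one-sided limit of [m0] that a minimizing sequence sees, and only this limit enters the
    supergradient. The midpoint in [field] makes [flux] appear without a jump correction: between
    the values w and w' the increment of [flux] is (w' - w) (w + w' - M) / 2, the mass of the jump
    times the field there. For w, w' in [0, M] the last factor is at most M / 2 in absolute value,
    which is the propagation speed. At fixed x, [mbar] may jump in time, so it cannot be
    differentiated under the integral. This is why a space derivative is first moved onto phi: the
    difference quotients of [nubar] in t are trapped between two values of [- flux]. Including t = 0
    in the inequality makes the initial condition an instance of continuity in time. *)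

Section monotone_functions.
Context {R : realType}.
Implicit Types (f : R -> R) (x y : R).

Lemma nondecreasing_is_cvg_left f : nondecreasing f ->
  forall x, cvg (f y @[y --> x^'-]).
Proof.
move=> ndf x; apply: nondecreasing_at_left_is_cvgr.
- by near=> b => y z _ _ /ndf.
- near=> b; exists (f x) => _ [y + <-]; rewrite /= in_itv/= => /andP[_ xy].
  exact/ndf/ltW.
Unshelve. all: by end_near. Qed.

Lemma llim_le f : nondecreasing f -> forall x, llim f x <= f x.
Proof.
move=> ndf x; apply: limr_le; first exact: nondecreasing_is_cvg_left.
by near=> y; apply/ndf/ltW; near: y; exact: nbhs_left_lt.
Unshelve. all: by end_near. Qed.

Lemma le_llim f : nondecreasing f -> forall x y, x < y -> f x <= llim f y.
Proof.
move=> ndf x y xy; apply: limr_ge; first exact: nondecreasing_is_cvg_left.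
by near=> z; apply/ndf/ltW; near: z; exact: nbhs_left_gt.
Unshelve. all: by end_near. Qed.

Lemma llim_nondecreasing f : nondecreasing f -> nondecreasing (llim f).
Proof.
move=> ndf x y; rewrite le_eqVlt => /predU1P[->//|xy].
exact: (le_trans (llim_le ndf x) (le_llim ndf xy)).
Qed.

Lemma le_rlim f x w : nondecreasing f ->
  (forall y, x < y -> w <= f y) -> w <= rlim f x.
Proof.
move=> ndf h; apply: limr_ge; first exact: nondecreasing_is_cvg_right.
by near=> y; apply: h; near: y; exact: nbhs_right_gt.
Unshelve. all: by end_near. Qed.

(** No one-sided continuity is required, so [m0] and the time slices of the solution are covered at
    once; values at jumps do not affect the Stieltjes measure. *)
Definition is_cdf (M : R) f : Prop :=
  [/\ nondecreasing f, f x @[x --> -oo] --> 0 & f x @[x --> +oo] --> M].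

Lemma is_cdf_ge0 M f x : is_cdf M f -> 0 <= f x.
Proof.
move=> [ndf f0 _]; rewrite -(cvg_lim _ f0)//; apply: limr_le.
  by apply/cvg_ex; exists 0.
by near=> y; apply: ndf; near: y; exact/nbhs_ninfty_le/num_real.
Unshelve. all: by end_near. Qed.

Lemma is_cdf_le M f x : is_cdf M f -> f x <= M.
Proof.
move=> [ndf _ fM]; rewrite -(cvg_lim _ fM)//; apply: limr_ge.
  by apply/cvg_ex; exists M.
by near=> y; apply: ndf; near: y; exact/nbhs_pinfty_ge/num_real.
Unshelve. all: by end_near. Qed.

(** Meaningful for [0 < w < M] only: elsewhere the set may be empty or unbounded below, and [inf]
    takes a default value. *)
Definition quantile f (w : R) : R := inf [set x | w <= f x].

Lemma quantile_has_inf M f w : is_cdf M f -> 0 < w < M ->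
  has_inf [set x | w <= f x].
Proof.
move=> [ndf f0 fM] /andP[w0 wM]; split.
  have : \forall x \near +oo, w < f x by exact: (cvgr_gt _ fM).
  by move=> /filter_ex[x /ltW]; exists x.
have : \forall x \near -oo, f x < w by exact: (cvgr_lt _ f0).
move=> /filter_ex[x fxw]; exists x => y /= wy.
rewrite leNgt; apply/negP => /ltW /ndf.
by rewrite leNgt (lt_le_trans fxw).
Qed.

(** Galois connection between [f] and its generalized inverse. The right limit is forced: without
    right continuity, [w <= f x] may fail at the infimum. *)
Lemma quantile_le M f w x : is_cdf M f -> 0 < w < M ->
  (quantile f w <= x) = (w <= rlim f x).
Proof.
move=> cf wM; have [[? ?] hlb] := quantile_has_inf cf wM.
have [ndf _ _] := cf.
apply/idP/idP => [qx|wx].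
  apply: le_rlim => // y xy.
  have /inf_adherent : 0 < y - quantile f w by rewrite subr_gt0 (le_lt_trans
    qx).
  move=> /(_ _ (quantile_has_inf cf wM))[z /= wz].
  by rewrite -/(quantile f w) addrC subrK => /ltW /ndf; exact: le_trans.
apply/ler_addgt0Pr => e e0; apply: ge_inf => //=.
by rewrite (le_trans wx)// nondecreasing_rlim_le// ltrDl.
Qed.

Lemma quantile_gt M f w x : is_cdf M f -> 0 < w < M ->
  (x < quantile f w) = (rlim f x < w).
Proof. by move=> cf wM; rewrite !ltNge (quantile_le _ cf). Qed.

(** Inversion exchanges the axes: a horizontal comparison of graphs becomes a bound on the
    difference of quantiles, uniform in [w]. This is how finite speed acts on quantiles. *)
Lemma quantile_shift M f g w d : is_cdf M f -> is_cdf M g -> 0 < w < M ->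
  (forall x, f x <= g (x + d)) -> quantile g w <= quantile f w + d.
Proof.
move=> cf cg wM fg; rewrite -lerBlDr.
have [fn _] := quantile_has_inf cf wM; apply: lb_le_inf => //.
move=> x /= wx; rewrite lerBlDr; apply: ge_inf.
  by have [] := quantile_has_inf cg wM.
by rewrite /= (le_trans wx).
Qed.

End monotone_functions.

Section integrals.
Context d (T : measurableType d) (R : realType).
Implicit Types mu : {measure set T -> \bar R}.

Lemma bounded_integrable mu (D : set T) (f : T -> R) (C : R) : measurable D ->
  (mu D < +oo)%E -> measurable_fun D f -> (forall x, D x -> `|f x| <= C) ->
  mu.-integrable D (EFin \o f).
Proof.
move=> mD muD mf fC; apply: measurable_bounded_integrable => //.
exists C; split; first exact: num_real.
by move=> y Cy x Dx; exact: le_trans (fC _ Dx) (ltW Cy).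
Qed.

Lemma integrable_EFinD mu (D : set T) (f g : T -> R) : measurable D ->
  mu.-integrable D (EFin \o f) -> mu.-integrable D (EFin \o g) ->
  mu.-integrable D (EFin \o (fun x => f x + g x)).
Proof. by move=> mD intf intg; have := integrableD mD intf intg. Qed.

Lemma integrable_EFinB mu (D : set T) (f g : T -> R) : measurable D ->
  mu.-integrable D (EFin \o f) -> mu.-integrable D (EFin \o g) ->
  mu.-integrable D (EFin \o (fun x => f x - g x)).
Proof. by move=> mD intf intg; have := integrableB mD intf intg. Qed.

Lemma integrable_EFinZl mu (D : set T) (f : T -> R) (r : R) : measurable D ->
  mu.-integrable D (EFin \o f) ->
  mu.-integrable D (EFin \o (fun x => r * f x)).
Proof. by move=> mD intf; have := integrableZl mD r intf. Qed.

Lemma bounded_cvg_Rintegral mu (D : set T) (f_ : nat -> T -> R) (f : T -> R)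
    (C : R) : measurable D -> (mu D < +oo)%E ->
  (forall n, measurable_fun D (f_ n)) -> measurable_fun D f ->
  {ae mu, forall x, D x -> f_ n x @[n --> \oo] --> f x} ->
  (forall n x, D x -> `|f_ n x| <= C) ->
  \int[mu]_(x in D) f_ n x @[n --> \oo] --> \int[mu]_(x in D) f x.
Proof.
move=> mD muD mf_ mf f_f fC.
have [] := @dominated_convergence _ _ _ mu D mD (fun n => EFin \o f_ n)
  (EFin \o f) (cst C%:E).
- by move=> n; exact/measurable_EFinP.
- exact/measurable_EFinP.
- apply: filterS f_f => x f_f Dx; apply: cvg_EFin; last exact: f_f.
  by near=> n.
(* A point of [D] is what gives [0 <= C]. *)
- have [->|/set0P[z Dz]] := eqVneq D set0; first exact: integrable_set0.
  apply: (@bounded_integrable mu D (cst C) C) => // x _ /=.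
  by rewrite ger0_norm// (le_trans _ (fC 0%N z Dz)).
- by apply: aeW => x n Dx /=; rewrite lee_fin fC.
move=> intf _ h; apply: fine_cvg; rewrite fineK//.
exact: integrable_fin_num.
Unshelve. all: by end_near. Qed.

Lemma integral_mrestr mu (D : set T) (mD : measurable D) (f : T -> \bar R) :
  (mrestr mu mD).-integrable setT f ->
  (\int[mrestr mu mD]_x f x = \int[mu]_(x in D) f x)%E.
Proof.
move=> intf.
rewrite (@negligible_integral _ _ _ (mrestr mu mD) _ (~` D))//; last 2 first.
- exact: measurableC.
- by rewrite /= /mrestr setICl measure0.
rewrite setTD setCK; apply: eq_measure_integral => A mA AD.
by rewrite /= /mrestr setIidl.
Qed.

End integrals.

(** * Stieltjes measures as images of Lebesgue measure *)

Section quantile_measure.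
Context {R : realType}.
Implicit Types (f : R -> R) (A : set R).
Local Notation leb := (@lebesgue_measure R).

Lemma lebesgue_measure_itv_bnd (a b : R) (x y : bool) : a <= b ->
  leb [set` Interval (BSide x a) (BSide y b)] = (b - a)%:E.
Proof.
move=> ab; rewrite lebesgue_measure_itv/= lte_fin lt_neqAle ab andbT.
by case: eqVneq => //= ->; rewrite subrr.
Qed.

Lemma lebesgue_stieltjes_measure_itv_oc (F : cumulative R R) (a b : R) :
  a <= b -> lebesgue_stieltjes_measure F `]a, b]%classic = (F b - F a)%:E.
Proof.
move=> ab; rewrite /lebesgue_stieltjes_measure /measure_extension/=.
by rewrite measurable_mu_extE/= ?wlength_itv_bnd//; exact: is_ocitv.
Qed.

Lemma measurable_quantile M f : is_cdf M f ->
  measurable_fun `]0, M[ (quantile f).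
Proof.
move=> cf mD; apply: (measurability _ (RGenOInfty.measurableE R)) => //.
move=> /= _ [_ [x ->] <-].
rewrite (_ : _ `&` _ = `]0, M[ `&` `]rlim f x, +oo[); first exact: measurableI.
apply/seteqP; split => w /= []; rewrite !in_itv/= !andbT => wM;
  by rewrite (quantile_gt _ cf wM).
Qed.

Lemma lebesgue_itv0oc (M a b : R) : 0 <= a -> a <= b -> b <= M ->
  leb (`]0, M[ `&` `]a, b]) = (b - a)%:E.
Proof.
move=> a0 ab bM; have [bM'|] := ltP b M.
  rewrite setIidr; first by rewrite lebesgue_measure_itv_bnd.
  move=> x /=; rewrite !in_itv/= => /andP[ax xb].
  by rewrite (le_lt_trans a0 ax) (le_lt_trans xb).
move=> Mb; have -> : b = M by apply/le_anti; rewrite bM Mb.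
rewrite (_ : _ `&` _ = `]a, M[%classic).
  by rewrite lebesgue_measure_itv_bnd// (le_trans ab).
apply/seteqP; split => x /=; rewrite !in_itv/=.
  by move=> [/andP[_ ->] /andP[->]].
by move=> /andP[ax xM]; rewrite ax xM (ltW xM) (le_lt_trans a0 ax).
Qed.

(** By the Galois connection, the preimage of []a, b]] under the quantile is []rlim f a, rlim f b]]
    inside []0, M[]; a Stieltjes measure is determined by its values on such intervals. *)
Lemma stieltjes_quantile M f A : is_cdf M f -> measurable A ->
  stieltjes f A = leb (`]0, M[ `&` quantile f @^-1` A).
Proof.
move=> cf mA; have [ndf _ _] := cf.
pose q := quantile f \_ `]0, M[.
have mq : measurable_fun setT (q : measurableTypeR R -> R).
  apply/(measurable_restrictT _ _).1 => //; exact: measurable_quantile.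
pose D : set (measurableTypeR R) := `]0, M[%classic.
have mD : measurable D by exact: measurable_itv.
have qE B : q @^-1` B `&` D = `]0, M[ `&` quantile f @^-1` B.
  rewrite setIC; apply/seteqP; split => w /= [Dw];
  by rewrite /q patchE mem_set//.
rewrite /stieltjes; case: pselect => // {}ndf.
transitivity (pushforward (mrestr leb mD) (q : measurableTypeR R ->
  measurableTypeR R) A).
  apply: lebesgue_stieltjes_measure_unique => // _ [[a b] _ <-] /=.
  rewrite /pushforward /mrestr/= qE.
  have [ab|ba] := leP a b; last first.
    rewrite set_itv_ge; last by rewrite bnd_simp -leNgt ltW.
    by rewrite preimage_set0 setI0 !measure0.
  rewrite lebesgue_stieltjes_measure_itv_oc//=.
  have rM x : rlim f x <= M.
    have xx1 : x < x + 1 by rewrite ltrDl.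
    by rewrite (le_trans (nondecreasing_rlim_le ndf xx1))// (is_cdf_le _ cf).
  have r0 x : 0 <= rlim f x.
    by rewrite (le_trans _ (nondecreasing_le_rlim ndf x))// (is_cdf_ge0 _ cf).
  rewrite -(@lebesgue_itv0oc M)//; last exact: rlim_nondecreasing.
  congr leb.
  apply/seteqP; split => w /= [wM]; rewrite !in_itv/= => h; split => //;
  by move: h; rewrite (quantile_gt _ cf)// (quantile_le _ cf).
by rewrite /pushforward /mrestr/= qE.
Qed.

(** Puts the integrals against all time slices on one fixed measure space, so that weak convergence
    of measures reduces to bounded convergence. *)
Lemma Rintegral_stieltjes_quantile M f (psi : R -> R) C : is_cdf M f ->
  measurable_fun setT psi -> (forall x, `|psi x| <= C) ->
  \int[stieltjes f]_x psi x = \int[leb]_(w in `]0, M[) psi (quantile f w).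
Proof.
move=> cf mpsi psiC; have [ndf _ _] := cf.
pose q := quantile f \_ `]0, M[.
have mq : measurable_fun setT (q : measurableTypeR R -> measurableTypeR R).
  apply/(measurable_restrictT _ _).1 => //; exact: measurable_quantile.
pose D : set (measurableTypeR R) := `]0, M[%classic.
have mD : measurable D by exact: measurable_itv.
have M0 : 0 <= M by rewrite (le_trans (is_cdf_ge0 0 cf))// (is_cdf_le _ cf).
have ipsi : (mrestr leb mD).-integrable setT (EFin \o psi \o q).
  apply: (@bounded_integrable _ _ _ (mrestr leb mD) setT (psi \o q) C) => //.
    by rewrite /= /mrestr setTI lebesgue_measure_itv_bnd// ltry.
    exact: measurableT_comp.
  by move=> x _; exact: psiC.
rewrite /Rintegral.
pose P : {measure set (measurableTypeR R) -> \bar R} :=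
  measure_function_pushforward__canonical__measure_function_Measure
    (mrestr leb mD) mq.
transitivity (fine (\int[P]_x (psi x)%:E)).
  congr fine; apply: eq_measure_integral => A mA _;
    rewrite (stieltjes_quantile cf)// /pushforward/= /mrestr.
  congr leb; apply/seteqP; split => w /= [].
    by move=> Dw qA; split => //; rewrite /q patchE mem_set.
  by move=> + Dw; rewrite /q patchE mem_set//.
rewrite [in LHS]integral_pushforward//; last exact/measurable_EFinP.
rewrite preimage_setT integral_mrestr//; congr fine.
by apply: eq_integral => w wD /=; rewrite /q patchE wD.
Qed.

End quantile_measure.

Section stieltjes_measure.
Context {R : realType}.
Implicit Types (f : R -> R) (x M : R).
Local Notation leb := (@lebesgue_measure R).

Lemma llim_gt_ex f x w : nondecreasing f -> w < llim f x ->
  exists2 y, y < x & w < f y.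
Proof.
move=> ndf wx.
have fx : f y @[y --> x^'-] --> llim f x by exact: nondecreasing_is_cvg_left.
have xp : ProperFilter x^'- by exact: at_left_proper_filter.
have [y [yx wy]] : exists y, y < x /\ w < f y.
  apply: (@filter_ex _ x^'-); near=> y; split; near: y.
    exact: nbhs_left_lt.
  exact: (cvgr_gt _ fx).
by exists y.
Unshelve. all: by end_near. Qed.

Lemma is_cdf_rlim_le M f x : is_cdf M f -> rlim f x <= M.
Proof.
move=> cf; have [ndf _ _] := cf; have xx1 : x < x + 1 by rewrite ltrDl.
by rewrite (le_trans (nondecreasing_rlim_le ndf xx1))// (is_cdf_le _ cf).
Qed.

Lemma is_cdf_rlim_ge0 M f x : is_cdf M f -> 0 <= rlim f x.
Proof.
move=> cf; have [ndf _ _] := cf.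
by rewrite (le_trans _ (nondecreasing_le_rlim ndf x))// (is_cdf_ge0 _ cf).
Qed.

Lemma is_cdf_llim_le M f x : is_cdf M f -> llim f x <= M.
Proof.
by move=> cf; have [ndf _ _] := cf;
  rewrite (le_trans (llim_le ndf x))// (is_cdf_le _ cf).
Qed.

Lemma is_cdf_llim_ge0 M f x : is_cdf M f -> 0 <= llim f x.
Proof.
move=> cf; have [ndf _ _] := cf; have xx1 : x - 1 < x by rewrite ltrBlDr ltrDl.
by rewrite (le_trans _ (le_llim ndf xx1))// (is_cdf_ge0 _ cf).
Qed.

Lemma is_cdf_mass_ge0 M f : is_cdf M f -> 0 <= M.
Proof.
by move=> cf; rewrite (le_trans (is_cdf_ge0 0 cf))// (is_cdf_le _ cf).
Qed.

(** In the applications the level [w = a] may or may not belong to [A]. *)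
Let lebesgue_squeeze (a : R) (A : set R) : 0 <= a -> measurable A ->
  `]0, a[ `<=` A -> A `<=` `]0, a] -> leb A = a%:E.
Proof.
move=> a0 mA aA Aa; apply/eqP; rewrite eq_le; apply/andP; split.
  have : (leb A <= leb `]0%R, a])%E by apply: le_measure => //; rewrite inE.
  by rewrite lebesgue_measure_itv_bnd// subr0.
have : (leb `]0%R, a[ <= leb A)%E by apply: le_measure => //; rewrite inE.
by rewrite lebesgue_measure_itv_bnd// subr0.
Qed.

Let measurable_quantile_preimage M f (A : set R) : is_cdf M f -> measurable A ->
  measurable (`]0, M[ `&` quantile f @^-1` A).
Proof. by move=> cf mA; exact: (measurable_quantile cf). Qed.

Lemma stieltjes_itvNyc M f x : is_cdf M f ->
  stieltjes f `]-oo, x]%classic = (rlim f x)%:E.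
Proof.
move=> cf; rewrite (stieltjes_quantile cf)//.
have rM := is_cdf_rlim_le x cf.
apply: lebesgue_squeeze => //; first exact: is_cdf_rlim_ge0 cf.
- exact: measurable_quantile_preimage.
- move=> w /=; rewrite !in_itv/= => /andP[w0 wr].
  have wM : 0 < w < M by rewrite w0 (lt_le_trans wr).
  by rewrite (quantile_le _ cf)// ltW.
- move=> w /=; rewrite !in_itv/= => -[wM].
  by rewrite (quantile_le _ cf)// => ->; case/andP: wM => ->.
Qed.

Lemma stieltjes_itvNyo M f x : is_cdf M f ->
  stieltjes f `]-oo, x[%classic = (llim f x)%:E.
Proof.
move=> cf; have [ndf _ _] := cf; rewrite (stieltjes_quantile cf)//.
have lM := is_cdf_llim_le x cf.
apply: lebesgue_squeeze => //; first exact: is_cdf_llim_ge0 cf.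
- exact: measurable_quantile_preimage.
- move=> w /=; rewrite !in_itv/= => /andP[w0 wr].
  have wM : 0 < w < M by rewrite w0 (lt_le_trans wr).
  have [y yx wy] := llim_gt_ex ndf wr; split => //.
  rewrite (le_lt_trans _ yx)// (quantile_le _ cf)//.
  by rewrite (le_trans (ltW wy))// nondecreasing_le_rlim.
- move=> w /=; rewrite !in_itv/= => -[wM qx].
  (* [quantile_le] at the quantile itself gives [w <= rlim f (quantile f w)]; a midpoint then
     separates this right limit from the left limit at [x]. *)
  have := lexx (quantile f w); rewrite {1}(quantile_le _ cf)// => wq.
  case/andP: (wM) => -> _ /=; rewrite (le_trans wq)//.
  have [qy yx] := midf_lt qx.
  by rewrite (le_trans (nondecreasing_rlim_le ndf qy))// le_llim.
Qed.

Lemma stieltjes_setT M f : is_cdf M f -> stieltjes f setT = M%:E.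
Proof.
move=> cf; rewrite (stieltjes_quantile cf)// preimage_setT setIT.
by rewrite lebesgue_measure_itv_bnd ?subr0//; exact: is_cdf_mass_ge0 cf.
Qed.

(** The sandwich has a horizontal tolerance but no vertical one, hence convergence at every level
    [w] and not merely at almost every one. *)
Lemma quantile_cvg M (f_ : nat -> R -> R) f w : (forall n, is_cdf M (f_ n)) ->
  is_cdf M f -> 0 < w < M ->
  (forall e, 0 < e ->
     \forall n \near \oo, forall x, f (x - e) <= f_ n x <= f (x + e)) ->
  quantile (f_ n) w @[n --> \oo] --> quantile f w.
Proof.
move=> cf_ cf wM f_f; apply/cvgrPdist_le => e e0.
apply: filterS (f_f e e0) => n fn; rewrite ler_distlC; apply/andP; split.
  rewrite lerBlDr; apply: (quantile_shift (cf_ n) cf wM) => x.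
  by case/andP: (fn x).
apply: (quantile_shift cf (cf_ n) wM) => x.
by have /andP[+ _] := fn (x + e); rewrite addrK.
Qed.

Lemma stieltjes_weak_cvg M (f_ : nat -> R -> R) f (psi : R -> R) :
  (forall n, is_cdf M (f_ n)) -> is_cdf M f ->
  (forall e, 0 < e ->
     \forall n \near \oo, forall x, f (x - e) <= f_ n x <= f (x + e)) ->
  continuous psi -> bounded_fun psi ->
  \int[stieltjes (f_ n)]_x psi x @[n --> \oo] --> \int[stieltjes f]_x psi x.
Proof.
move=> cf_ cf f_f cpsi [C [_ /(_ (C + 1))]];
  rewrite ltrDl ltr01 => /(_ isT) psiC.
have {}psiC x : `|psi x| <= C + 1 by exact: psiC.
have mpsi : measurable_fun setT psi by exact: continuous_measurable_fun.
rewrite (Rintegral_stieltjes_quantile cf mpsi psiC).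
under eq_fun do rewrite (Rintegral_stieltjes_quantile (cf_ _) mpsi psiC).
have lM : (leb `]0%R, M[ < +oo)%E.
  by rewrite lebesgue_measure_itv_bnd ?ltry//; exact: is_cdf_mass_ge0 cf.
apply: (@bounded_cvg_Rintegral _ _ _ _ _ _ _ (C + 1)) => //.
- by move=> n; apply: measurableT_comp => //; exact: measurable_quantile.
- by apply: measurableT_comp => //; exact: measurable_quantile.
- apply: aeW => w; rewrite /= in_itv/= => wM.
  apply: (continuous_cvg _ (cpsi _)); exact: quantile_cvg cf_ cf wM f_f.
Qed.

End stieltjes_measure.

(** * Chain rule and integration by parts for finite measures *)

Section finite_measure_cdf.
Context {R : realType}.
Variable nu : {finite_measure set (measurableTypeR R) -> \bar R}.
Implicit Types x y : R.

Lemma fine_measureK (A : set R) : measurable A -> (fine (nu A))%:E = nu A.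
Proof. by move=> mA; rewrite fineK// fin_num_measure. Qed.

Lemma m0_nondecreasing : nondecreasing (m0 nu).
Proof.
move=> x y xy; rewrite /m0 fine_le ?fin_num_measure//.
apply: le_measure; rewrite ?inE//= => z /=.
by rewrite !in_itv/= => /lt_le_trans; apply.
Qed.

Lemma m0_cvg_bigcap (u : nat -> R) (A : set R) : nonincreasing_seq u ->
  measurable A -> \bigcap_n `]-oo, u n[%classic = A ->
  m0 nu (u n) @[n --> \oo] --> fine (nu A).
Proof.
move=> du mA uA; apply: fine_cvg; rewrite fine_measureK// -uA.
apply: nonincreasing_cvg_mu => //=.
- by rewrite -ge0_fin_numE// fin_num_measure.
- by rewrite uA.
- move=> n m /du unm; apply/subsetPset => z /=.
  by rewrite !in_itv/= => /lt_le_trans; apply.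
Qed.

Lemma m0_cvg_bigcup (u : nat -> R) (A : set R) : nondecreasing_seq u ->
  measurable A -> \bigcup_n `]-oo, u n[%classic = A ->
  m0 nu (u n) @[n --> \oo] --> fine (nu A).
Proof.
move=> du mA uA; apply: fine_cvg; rewrite fine_measureK// -uA.
apply: nondecreasing_cvg_mu => //=.
- by rewrite uA.
- move=> n m /du unm; apply/subsetPset => z /=.
  by rewrite !in_itv/= => /lt_le_trans; apply.
Qed.

Lemma m0_is_cdf : is_cdf (mass nu) (m0 nu).
Proof.
have ndm := m0_nondecreasing.
have ub x : x < (Num.bound `|x|)%:R.
  by rewrite (le_lt_trans (ler_norm _))// archi_boundP.
split => //; apply/cvgrPdist_le => e e0.
- have /cvgrPdist_lt/(_ _ e0) :
    m0 nu (- n%:R) @[n --> \oo] --> fine (nu set0).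
    apply: m0_cvg_bigcap => //.
      by move=> n m nm; rewrite lerN2 ler_nat.
    rewrite -subset0 => x /(_ (Num.bound `|- x|) I)/=; rewrite in_itv/= ltrNr.
    by move=> /(lt_trans (ub _)); rewrite ltxx.
  rewrite measure0 => -[N _ /(_ _ (leqnn N))].
  rewrite /= !sub0r !normrN => h.
  near=> x; rewrite sub0r normrN ger0_norm ?fine_ge0//.
  apply/ltW; apply: le_lt_trans h; rewrite ger0_norm ?fine_ge0//.
  by apply: ndm; near: x; exact/nbhs_ninfty_le/num_real.
- have /cvgrPdist_lt/(_ _ e0) :
    m0 nu n%:R @[n --> \oo] --> mass nu.
    apply: m0_cvg_bigcup => //.
      by move=> n m nm; rewrite ler_nat.
    rewrite -subTset => x _; exists (Num.bound `|x|) => //=.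
    by rewrite in_itv/=.
  move=> -[N _ /(_ _ (leqnn N))] h.
  have mM x : m0 nu x <= mass nu.
    rewrite fine_le ?fin_num_measure//.
    by apply: le_measure; rewrite ?inE//=.
  near=> x; rewrite ger0_norm ?subr_ge0//; apply/ltW.
  apply: le_lt_trans h; rewrite ger0_norm ?subr_ge0// lerB//.
  by apply: ndm; near: x; exact/nbhs_pinfty_ge/num_real.
Unshelve. all: by end_near. Qed.

(** []-oo, x[] is the increasing union of the half-lines []-oo, x - 1/(n+1)[]. *)
Lemma llim_m0 x : llim (m0 nu) x = m0 nu x.
Proof.
have ndm := m0_nondecreasing.
apply/le_anti; rewrite llim_le//=.
have cv : m0 nu (x - n.+1%:R^-1) @[n --> \oo] --> m0 nu x.
  apply: m0_cvg_bigcup => //.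
    by move=> n m nm; rewrite lerB// lef_pV2 ?posrE// ler_nat.
  apply/seteqP; split => z /=.
    by move=> [n _]; rewrite /= !in_itv/= => /lt_le_trans; apply; rewrite gerBl.
  rewrite in_itv/= => zx.
  have /ltr_add_invr[n zn] : z < x by [].
  by exists n => //=; rewrite in_itv/= ltrBrDr.
rewrite -(cvg_lim _ cv)//; apply: limr_le; first by apply/cvg_ex;
  exists (m0 nu x).
by near=> n; apply: le_llim => //; rewrite gtrBl invr_gt0.
Unshelve. all: by end_near. Qed.

Lemma rlim_m0 x : rlim (m0 nu) x = fine (nu `]-oo, x]%classic).
Proof.
have ndm := m0_nondecreasing.
apply/le_anti/andP; split; last first.
  apply: le_rlim => // y xy; rewrite fine_le ?fin_num_measure//.
  apply: le_measure; rewrite ?inE//= => z /=.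
  by rewrite !in_itv/= => /le_lt_trans; apply.
have cv : m0 nu (x + n.+1%:R^-1) @[n --> \oo] --> fine (nu `]-oo, x]%classic).
  apply: m0_cvg_bigcap => //.
    by move=> n m nm; rewrite lerD2l lef_pV2 ?posrE// ler_nat.
  apply/seteqP; split => z /=; last first.
    move=> + n _ /=; rewrite !in_itv/= => /le_lt_trans; apply.
    by rewrite ltrDl invr_gt0.
  move=> h; rewrite in_itv/= leNgt; apply/negP => /ltr_add_invr[n zn].
  have := h n I; rewrite /= in_itv/= ltNge => /negP; apply; exact: ltW.
rewrite -(cvg_lim _ cv)//; apply: limr_ge.
  by apply/cvg_ex; exists (fine (nu `]-oo, x]%classic)).
by near=> n; apply: nondecreasing_rlim_le => //; rewrite ltrDl invr_gt0.
Unshelve. all: by end_near. Qed.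

Lemma stieltjes_m0 (A : set R) : measurable A -> stieltjes (m0 nu) A = nu A.
Proof.
move=> mA; rewrite /stieltjes; case: pselect => [ndm|/(_ m0_nondecreasing)//].
apply: lebesgue_stieltjes_measure_unique => // _ [[a b] _ <-] /=.
have [ab|ba] := leP a b; last first.
  by rewrite set_itv_ge ?measure0// bnd_simp -leNgt ltW.
rewrite lebesgue_stieltjes_measure_itv_oc//= !rlim_m0 EFinB !fine_measureK//.
have -> : `]a, b]%classic = `]-oo, b] `\` `]-oo, a].
  apply/seteqP; split => z /=; rewrite !in_itv/=.
    by move=> /andP[az zb]; split => //; apply/negP; rewrite -ltNge.
  by move=> [zb /negP]; rewrite -ltNge => az; rewrite az.
rewrite measureD ?setIidr//.
  by move=> z /=; rewrite !in_itv/= => /le_trans; apply.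
by rewrite -ge0_fin_numE// fin_num_measure.
Qed.

End finite_measure_cdf.

(* Its differential along a distribution function m is field M m dm. *)
Definition flux {R : realType} (M w : R) : R := (w ^+ 2 - M * w) / 2.

(** * Chain rule for the midpoint value *)

Section fubini_applications.
Context {R : realType}.
Variable nu : {finite_measure set (measurableTypeR R) -> \bar R}.
Implicit Types x y z : R.
Local Notation RR := (measurableTypeR R).

Let nu_fin (A : set RR) : measurable A -> (nu A < +oo)%E.
Proof. by move=> mA; rewrite -ge0_fin_numE// fin_num_measure. Qed.

Lemma measurable_lt_fst_snd : measurable [set p : RR * RR | p.1 < p.2].
Proof.
rewrite (_ : [set p | _] = setT `&` (fun p : RR * RR =>
  p.2 - p.1) @^-1` `]0, +oo[).
  apply: (_ : measurable_fun setT _) => //.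
  by apply: measurable_funB.
by apply/seteqP; split => p /=; rewrite in_itv/= andbT subr_gt0 => // -[].
Qed.

Lemma m0_le_mass x : m0 nu x <= mass nu.
Proof. by have := is_cdf_le x (m0_is_cdf nu). Qed.

Lemma m0_ge0 x : 0 <= m0 nu x.
Proof. by have := is_cdf_ge0 x (m0_is_cdf nu). Qed.

Lemma rlim_m0_nondecreasing : nondecreasing (rlim (m0 nu)).
Proof. exact/rlim_nondecreasing/m0_nondecreasing. Qed.

Let intd (f : R -> R) (A : set R) : measurable A -> nondecreasing f ->
  (forall x, 0 <= f x <= mass nu) -> nu.-integrable A (EFin \o f).
Proof.
move=> mA ndf fM; apply: (@bounded_integrable _ _ _ _ _ _ (mass nu)) => //.
- exact: nu_fin.
- exact: nondecreasing_measurable.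
- by move=> x _; case/andP: (fM x) => f0 f1; rewrite ger0_norm.
Qed.

Lemma integrable_m0 (A : set R) : measurable A ->
  nu.-integrable A (EFin \o m0 nu).
Proof.
move=> mA; apply: intd => //; first exact: m0_nondecreasing.
by move=> x; rewrite m0_ge0 m0_le_mass.
Qed.

Lemma integrable_rlim_m0 (A : set R) : measurable A ->
  nu.-integrable A (EFin \o rlim (m0 nu)).
Proof.
move=> mA; apply: intd => //; first exact: rlim_m0_nondecreasing.
move=> x; rewrite (is_cdf_rlim_le _ (m0_is_cdf nu)).
by rewrite (is_cdf_rlim_ge0 _ (m0_is_cdf nu)).
Qed.

Lemma integrable_cst_finite (A : set R) (r : R) : measurable A ->
  nu.-integrable A (EFin \o cst r).
Proof.
move=> mA; apply: (@bounded_integrable _ _ _ _ _ _ `|r|) => //.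
exact: nu_fin.
Qed.

Let setI_lt y z : `]-oo, y[%classic `\` `]-oo, z[%classic =
  `[z, y[%classic :> set R.
Proof.
apply/seteqP; split => x /=; rewrite !in_itv/=.
  by move=> [-> /negP]; rewrite -leNgt => ->.
by move=> /andP[zx xy]; split => //; apply/negP; rewrite -leNgt.
Qed.

Lemma measure_itvco y z : z <= y -> nu `[z, y[%classic = (m0 nu y - m0 nu z)%:E.
Proof.
move=> zy; rewrite -setI_lt measureD//; last exact: nu_fin.
rewrite setIidr; last by move=> x /=; rewrite !in_itv/= => /lt_le_trans; apply.
by rewrite EFinB !fine_measureK.
Qed.

(* Tonelli for the indicator of {z <= x < y}. *)
Lemma Rintegral_rlim_m0 y :
  \int[nu]_(x in `]-oo, y[) rlim (m0 nu) x =
  \int[nu]_(z in `]-oo, y[) (m0 nu y - m0 nu z).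
Proof.
pose B : set (RR * RR) := [set p | p.2 <= p.1 /\ p.1 < y].
have mB : measurable B.
  rewrite (_ : B = ~` [set p | p.1 < p.2] `&` (fst @^-1` `]-oo, y[)).
    apply: measurableI; first by apply: measurableC;
      exact: measurable_lt_fst_snd.
    rewrite -[X in measurable X]setTI; exact: measurable_fst.
  apply/seteqP; split => p; rewrite /B/= in_itv/= => -[h ->]; split => //.
    by apply/negP; rewrite -leNgt.
  by rewrite leNgt; apply/negP.
have := @fubini_tonelli _ _ RR RR R nu nu (EFin \o \1_B).
have -> : (fun x => \int[nu]_z (EFin \o \1_B) (x, z))%E =
    (EFin \o rlim (m0 nu)) \_ `]-oo, y[.
  apply/funext => x; rewrite patchE; case: ifPn => [|].
    rewrite inE/= in_itv/= => xy; rewrite rlim_m0 fine_measureK//.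
    under eq_integral => z _.
      rewrite /= (_ : \1_B (x, z) = \1_(`]-oo, x]%classic : set RR) z).
        over.
      rewrite !indicE; congr ((nat_of_bool _)%:R); apply/is_true_inj/propext.
      by rewrite !inE /B/= in_itv/=; split => [[]|].
    by rewrite integral_indic// setIT.
  move=> /negP; rewrite inE/= in_itv/= => xy.
  rewrite integral0_eq// => z _ /=; rewrite indicE memNset//.
  by rewrite /B/= => -[].
have -> : (fun z => \int[nu]_x (EFin \o \1_B) (x, z))%E =
    (EFin \o (fun z => m0 nu y - m0 nu z)) \_ `]-oo, y[.
  apply/funext => z; rewrite patchE; case: ifPn => [|].
    rewrite inE/= in_itv/= => zy; rewrite -measure_itvco ?ltW//.
    under eq_integral => x _.
      rewrite /= (_ : \1_B (x, z) = \1_(`[z, y[%classic : set RR) x).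
        over.
      rewrite !indicE; congr ((nat_of_bool _)%:R); apply/is_true_inj/propext.
      by rewrite !inE /B/= in_itv/=; split => [[-> ->]|/andP[]].
    by rewrite integral_indic// setIT.
  move=> /negP; rewrite inE/= in_itv/= => zy.
  rewrite integral0_eq// => x _ /=; rewrite indicE memNset//.
  by rewrite /B/= => -[/le_lt_trans] /[apply].
move=> h; rewrite /Rintegral; congr fine.
rewrite [LHS]integral_mkcond [RHS]integral_mkcond; apply: h => //.
  by apply/measurable_EFinP; exact: measurable_indic.
by move=> x; rewrite lee_fin indicE.
Qed.

(** The integrals of [m0] and of [rlim m0] each depend on the atoms, but by [Rintegral_rlim_m0]
    their sum is exactly [m0 nu y ^+ 2]. *)
Lemma Rintegral_field_m0 y :
  \int[nu]_(x in `]-oo, y[) field (mass nu) (m0 nu) x =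
  flux (mass nu) (m0 nu y).
Proof.
have mI : measurable (`]-oo, y[%classic : set RR) by exact: measurable_itv.
under eq_Rintegral do rewrite /field llim_m0.
rewrite RintegralZr//; last first.
  apply: integrable_EFinB => //; last exact: integrable_cst_finite.
  apply: integrable_EFinD => //; [exact: integrable_m0|exact:
    integrable_rlim_m0].
rewrite RintegralB//; last 2 first.
- apply: integrable_EFinD => //;
  [exact: integrable_m0|exact: integrable_rlim_m0].
- exact: integrable_cst_finite.
rewrite RintegralD//; [|exact: integrable_m0|exact: integrable_rlim_m0].
rewrite Rintegral_rlim_m0 RintegralB//; last 2 first.
- exact: integrable_cst_finite.
- exact: integrable_m0.
rewrite !Rintegral_cst// -/(m0 nu y) /flux; ring.
Qed.

End fubini_applications.

(** * Integration by parts against a finite measure *)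

Section integration_by_parts_measure.
Context {R : realType}.
Variable nu : {finite_measure set (measurableTypeR R) -> \bar R}.
Local Notation leb := (@lebesgue_measure R).
Local Notation RR := (measurableTypeR R).

Lemma continuous_Rintegral_derive (f F : R -> R) a b : a <= b ->
  continuous f -> (forall x, is_derive x (1 : R) F (f x)) ->
  \int[leb]_(x in `[a, b]) f x = F b - F a.
Proof.
move=> ab cf dF.
have cF : continuous F.
  by move=> x; apply: differentiable_continuous; apply/derivable1_diffP;
    apply: ex_derive.
have [ab'|ba] := ltP a b; last first.
  have -> : b = a by apply/le_anti; rewrite ab ba.
  by rewrite set_itv1 Rintegral_set1 subrr.
rewrite /Rintegral (@continuous_FTC2 _ _ F)//.
- by apply: continuous_subspaceT.
- split.
  + by move=> x _; apply: ex_derive.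
  + exact/cvg_at_right_filter/cF.
  + exact/cvg_at_left_filter/cF.
- by move=> x _; rewrite derive1E derive_val.
Qed.

Variables (g phi phi' : R -> R) (c d K K' : R).
Hypotheses (cd : c <= d) (mg : measurable_fun setT g)
  (gK : forall x, `|g x| <= K) (cphi' : continuous phi')
  (dphi : forall x, is_derive x (1 : R) phi (phi' x))
  (phi'K : forall x, `|phi' x| <= K')
  (phic : forall x, x <= c -> phi x = 0) (phid : forall x, d <= x -> phi x = 0).

(** Since [phi x] is minus the integral of [phi'] over []x, d]], the integral of [phi * g] is a
    double integral of this kernel. The second variable is confined to [[c, d]] below to keep the
    product measure finite. *)
Let h (p : RR * RR) : R :=
  \1_[set p : RR * RR | p.1 < p.2] p * (phi' p.2 * g p.1).

Let mphi' : measurable_fun setT phi'.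
Proof. exact: continuous_measurable_fun. Qed.

Let mh : measurable_fun setT h.
Proof.
apply: measurable_funM.
  by apply: measurable_indic; exact: measurable_lt_fst_snd.
by apply: measurable_funM; apply: measurableT_comp.
Qed.

Let D : set (RR * RR) := setT `*` (`[c, d]%classic : set RR).

Let mD : measurable D.
Proof. by apply: measurableX => //; exact: measurable_itv. Qed.

Let inth : (nu \x leb)%E.-integrable setT ((EFin \o h) \_ D).
Proof.
apply/(integrable_mkcond _ mD).1.
have K0 : 0 <= K := le_trans (normr_ge0 _) (gK 0).
have K'0 : 0 <= K' := le_trans (normr_ge0 _) (phi'K 0).
apply: (@bounded_integrable _ _ _ _ _ h (K' * K)) => //.
- rewrite [X in (X < _)%E](_ : _ = (nu setT * leb `[c, d])%E); last first.
    by apply: product_measure1E => //; exact: measurable_itv.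
  rewrite lebesgue_measure_itv_bnd//
    -ge0_fin_numE ?mule_ge0 ?lee_fin ?subr_ge0//.
  by rewrite fin_numM// fin_num_measure.
- exact: measurable_funTS.
- move=> p _; rewrite /h normrM normrM -[leRHS]mul1r.
  apply: ler_pM => //; [|exact: ler_pM].
  by rewrite indicE; case: (_ \in _); rewrite ?normr1 ?normr0.
Qed.

Let iphi' (A : set R) : measurable A -> A `<=` `[c, d]%classic ->
  leb.-integrable A (EFin \o phi').
Proof.
move=> mA Acd.
have icd : leb.-integrable `[c, d]%classic (EFin \o phi').
  apply: continuous_compact_integrable; first exact: segment_compact.
  exact: continuous_subspaceT.
apply: integrableS icd => //; exact: measurable_itv.
Qed.

Let inner1 x :
  (\int[leb]_z ((EFin \o h) \_ D) (x, z) = (- (phi x * g x))%:E)%E.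
Proof.
have E : forall z, ((EFin \o h) \_ D) (x, z) =
    ((fun z => (g x * phi' z)%:E) \_ (`[c, d] `&` `]x, +oo[)) z.
  move=> z; rewrite !patchE /D in_setX !in_setI in_setT /= .
  case: (z \in _) => //=; rewrite /h indicE/=.
  have -> : ((x, z) \in [set p : RR * RR | p.1 < p.2]) =
    (z \in `]x, +oo[%classic).
    by apply/is_true_inj/propext; rewrite !inE/= in_itv/= andbT.
  by case: (z \in _); rewrite ?mul1r ?mul0r 1?mulrC.
under eq_integral do rewrite E.
rewrite -integral_mkcond.
have sub A : measurable A -> A `<=` `[c, d] ->
    (\int[leb]_(z in A) (g x * phi' z)%:E)%E =
      (g x * \int[leb]_(z in A) phi' z)%:E.
  move=> mA Acd; have iA := iphi' mA Acd.
  rewrite -RintegralZl// /Rintegral fineK//.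
  by apply: integrable_fin_num => //; exact: integrable_EFinZl.
rewrite sub; last first.
- by move=> z [].
- exact: measurableI.
rewrite -mulNr mulrC; congr (_ * _)%:E.
(* For [x < c] the whole of [[c, d]] is integrated and gives [phi d - phi c = 0]; for [d <= x]
   nothing is left; in between the result is [phi d - phi x]. *)
have [xc|cx] := ltP x c.
  rewrite setIidl; last first.
    by move=> z /=; rewrite !in_itv/= andbT => /andP[+ _]; exact: lt_le_trans.
  rewrite (continuous_Rintegral_derive _ _ dphi)//.
  by rewrite phid// phic// phic ?subrr ?oppr0// ltW.
have [dx|xd] := leP d x.
  rewrite [X in \int[_]_(_ in X) _](_ : _ = set0); last first.
    rewrite -subset0 => z /= []; rewrite !in_itv/= andbT => /andP[_ zd].
    by rewrite ltNge (le_trans zd).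
  by rewrite Rintegral_set0 phid// oppr0.
rewrite [X in \int[_]_(_ in X) _](_ : _ = `]x, d]%classic); last first.
  apply/seteqP; split => z /=; rewrite !in_itv/= andbT.
    by move=> [/andP[_ ->] ->].
  by move=> /andP[xz ->]; rewrite (le_trans cx (ltW xz)).
rewrite Rintegral_itv_obnd_cbnd; last first.
  apply: iphi' => // z /=; rewrite !in_itv/= => /andP[xz ->].
  by rewrite (le_trans cx (ltW xz)).
by rewrite (continuous_Rintegral_derive _ _ dphi) ?ltW// phid// sub0r.
Qed.

Let inner2 z : (\int[nu]_x ((EFin \o h) \_ D) (x, z))%E =
  ((fun z => (phi' z * \int[nu]_(x in `]-oo, z[) g x)%:E) \_ `[c, d]) z.
Proof.
rewrite patchE; case: ifPn => zcd; last first.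
  rewrite integral0_eq// => x _; rewrite patchE /D in_setX in_setT/=.
  by rewrite (negbTE zcd).
have mI : measurable (`]-oo, z[%classic : set RR) by exact: measurable_itv.
have ig : nu.-integrable `]-oo, z[ (EFin \o g).
  apply: (@bounded_integrable _ _ _ _ _ _ K) => //;
    last exact: measurable_funTS.
  by rewrite -ge0_fin_numE// fin_num_measure.
rewrite -RintegralZl// /Rintegral fineK//; last first.
  by apply: integrable_fin_num => //; exact: integrable_EFinZl.
rewrite [RHS]integral_mkcond; apply: eq_integral => x _.
rewrite !patchE /D in_setX in_setT/= zcd /h indicE/=.
have -> : ((x, z) \in [set p : RR * RR | p.1 < p.2]) =
  (x \in `]-oo, z[%classic).
  by apply/is_true_inj/propext; rewrite !inE/= ?in_itv/=.
by case: (x \in _); rewrite ?mul1r ?mul0r.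
Qed.

(** Fubini for [h]. The strict inequality in its indicator is what leaves the open half-line []-oo,
    z[], as in the definition of [m0]. *)
Lemma Rintegral_by_parts_measure : \int[nu]_x (phi x * g x) =
  - \int[leb]_(z in `[c, d]) (phi' z * \int[nu]_(x in `]-oo, z[) g x).
Proof.
have := Fubini inth.
under eq_integral do rewrite inner1.
under [in RHS]eq_integral do rewrite inner2.
rewrite -integral_mkcond => fub.
(* Up to sign this function is an inner integral of [h], so Fubini already provides its
   integrability. *)
have iphi : nu.-integrable setT (EFin \o (fun x => phi x * g x)).
  have := integrable_fubini_F inth.
  have -> : fubini_F leb ((EFin \o h) \_ D) = EFin \o (fun x =>
    - (phi x * g x)).
    by apply/funext => x; rewrite /fubini_F inner1.
  move=> /(integrable_EFinZl (-1) measurableT).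
  by under eq_fun do rewrite mulN1r opprK.
rewrite [in RHS]/Rintegral -fub.
rewrite -[in RHS]/(Rintegral nu setT (fun x => - (phi x * g x))).
under [in RHS]eq_Rintegral do rewrite -mulN1r.
by rewrite RintegralZl// mulN1r opprK.
Qed.

End integration_by_parts_measure.

(** * Consequences of the supergradient inequality *)

Section supergradient.
Context {R : realType}.
(** Applied with [m := mext rho0], the extension of [mbar] to t = 0, and [V := nubar rho0]. *)
Variables (M : R) (m V : R -> R -> R).
Hypothesis m_ge0 : forall x t, 0 <= t -> 0 <= m x t.
Hypothesis m_le : forall x t, 0 <= t -> m x t <= M.
Hypothesis supergradient : forall x t x' t', 0 <= t -> 0 <= t' ->
  V x' t' <= V x t - (x' - x) * m x t - (t' - t) * flux M (m x t).
Hypothesis m_init : is_cdf M (m ^~ 0).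
Implicit Types x t e : R.

Let M0 : 0 <= M. Proof. exact: is_cdf_mass_ge0 m_init. Qed.

(* Add the supergradient inequalities at the two points and bound the mean slope
   of flux on [0, M] by M / 2. *)
Lemma supergradient_finite_speed x t x' t' : 0 <= t -> 0 <= t' ->
  `|t' - t| * (M / 2) < x' - x -> m x t <= m x' t'.
Proof.
move=> t0 t'0 h; rewrite leNgt; apply/negP => lt.
have k1 := supergradient x x' t0 t'0; have k2 := supergradient x' x t'0 t0.
have P : 0 <= (m x' t' - m x t) *
    ((x' - x) + (t' - t) * ((m x' t' + m x t - M) / 2)).
  move: k1 k2; rewrite /flux => k1 k2; lra.
have Q : `|(t' - t) * ((m x' t' + m x t - M) / 2)| <= `|t' - t| * (M / 2).
  rewrite normrM ler_wpM2l//.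
  have := m_ge0 x t0; have := m_le x t0.
  have := m_ge0 x' t'0; have := m_le x' t'0.
  rewrite ler_norml => *; apply/andP; split; lra.
move: Q; rewrite ler_norml => /andP[Q _].
have B : 0 < (x' - x) + (t' - t) * ((m x' t' + m x t - M) / 2) by lra.
by move: P; rewrite pmulr_lge0// subr_ge0 leNgt lt.
Qed.

Lemma supergradient_nondecreasing t : 0 <= t -> nondecreasing (m ^~ t).
Proof.
move=> t0 x y; rewrite le_eqVlt => /predU1P[->//|xy].
by apply: supergradient_finite_speed => //; rewrite subrr normr0 mul0r subr_gt0.
Qed.

Lemma supergradient_shift t t' e x : 0 <= t -> 0 <= t' ->
  `|t' - t| * (M / 2) < e -> m (x - e) t <= m x t' <= m (x + e) t.
Proof.
move=> t0 t'0 te; apply/andP; split; apply: supergradient_finite_speed => //.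
  lra.
by rewrite distrC; lra.
Qed.

(** Finite speed traps the slice between two shifts of the initial one, so no mass escapes to
    infinity. The [+ 1] in [e] makes the speed condition strict. *)
Lemma supergradient_is_cdf t : 0 <= t -> is_cdf M (m ^~ t).
Proof.
move=> t0; pose e := `|t| * (M / 2) + 1.
have sh x : m (x - e) 0 <= m x t <= m (x + e) 0.
  by apply: supergradient_shift => //; rewrite subr0 /e ltrDl.
have [_ h0 hM] := m_init.
split; first exact: supergradient_nondecreasing.
- apply/cvgrPdist_lt => d d0.
  have /filter_ex[y] : \forall x \near -oo, m x 0 < d by exact: (cvgr_lt _ h0).
  move=> yd; near=> x.
  rewrite sub0r normrN ger0_norm ?m_ge0//.
  have /andP[_ +] := sh x; move=> /le_lt_trans; apply.
  apply: le_lt_trans yd; apply: supergradient_nondecreasing => //.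
  by rewrite -lerBrDr; near: x; exact/nbhs_ninfty_le/num_real.
- apply/cvgrPdist_lt => d d0.
  have Md : M - d < M by rewrite ltrBlDr ltrDl.
  have /filter_ex[y] : \forall x \near +oo, M - d < m x 0.
    exact: (cvgr_gt _ hM).
  move=> yd; near=> x.
  rewrite ger0_norm ?subr_ge0 ?m_le// ltrBlDr addrC -ltrBlDr.
  have /andP[+ _] := sh x; apply: lt_le_trans.
  apply: lt_le_trans yd _; apply: supergradient_nondecreasing => //.
  by rewrite lerBrDr; near: x; exact/nbhs_pinfty_ge/num_real.
Unshelve. all: by end_near. Qed.

Lemma supergradient_near_shift (u : nat -> R) t e : 0 <= t ->
  (forall n, 0 <= u n) -> u n @[n --> \oo] --> t -> 0 < e ->
  \forall n \near \oo, forall x, m (x - e) t <= m x (u n) <= m (x + e) t.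
Proof.
move=> t0 u0 ut e0.
(* [M / 2 + 1] in place of [M / 2], which is 0 when there is no mass. *)
have d0 : 0 < e / (M / 2 + 1) by rewrite divr_gt0// ltr_wpDl// divr_ge0.
move/cvgrPdist_lt : ut => /(_ _ d0); apply: filterS => n un x.
apply: supergradient_shift => //.
move: un; rewrite distrC ltr_pdivlMr ?ltr_wpDl ?divr_ge0//; apply: le_lt_trans.
by rewrite ler_wpM2l// lerDl.
Qed.

Lemma supergradient_weak_cvg (u : nat -> R) t (psi : R -> R) : 0 <= t ->
  (forall n, 0 <= u n) -> u n @[n --> \oo] --> t ->
  continuous psi -> bounded_fun psi ->
  \int[stieltjes (m ^~ (u n))]_x psi x @[n --> \oo] -->
    \int[stieltjes (m ^~ t)]_x psi x.
Proof.
move=> t0 u0 ut cpsi bpsi; apply: (@stieltjes_weak_cvg _ M) => //.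
- by move=> n; exact: supergradient_is_cdf.
- exact: supergradient_is_cdf.
- by move=> e e0; exact: supergradient_near_shift.
Qed.

(** Where the limit slice is continuous, the horizontal sandwich becomes pointwise convergence; by
    [ae_llim_rlim] this is almost everywhere. *)
Lemma supergradient_cvg (u : nat -> R) t x : 0 <= t ->
  (forall n, 0 <= u n) -> u n @[n --> \oo] --> t ->
  llim (m ^~ t) x = rlim (m ^~ t) x ->
  m x (u n) @[n --> \oo] --> m x t.
Proof.
move=> t0 u0 ut lr.
have ndm := supergradient_nondecreasing t0.
have mE : m x t = rlim (m ^~ t) x.
  apply/le_anti; rewrite (nondecreasing_le_rlim ndm)/= -lr.
  exact: (llim_le ndm).
apply/cvgrPdist_lt => e e0.
have [y yx hy] : exists2 y, y < x & m x t - e < m y t.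
  by apply: (llim_gt_ex ndm); rewrite lr -mE ltrBlDr ltrDl.
have [z xz hz] : exists2 z, x < z & m z t < m x t + e.
  have xp : ProperFilter x^'+ by exact: at_right_proper_filter.
  have cv : m z t @[z --> x^'+] --> m x t.
    by rewrite mE; exact: nondecreasing_is_cvg_right.
  have [z [xz ze]] : exists z, x < z /\ m z t < m x t + e.
    apply: (@filter_ex _ x^'+); near=> z; split; near: z.
      exact: nbhs_right_gt.
    by apply: (cvgr_lt _ cv); rewrite ltrDl.
  by exists z.
pose d := Num.min (x - y) (z - x).
have d0 : 0 < d by rewrite /d lt_min !subr_gt0 yx xz.
have := supergradient_near_shift t0 u0 ut d0;
  apply: filterS => n /(_ x) /andP[h1 h2].
rewrite ltr_distlC; apply/andP; split.
  apply: lt_le_trans hy (le_trans _ h1); apply: ndm.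
  by rewrite lerBrDr -lerBrDl ge_min lexx.
apply: le_lt_trans (le_trans h2 _) hz; apply: ndm.
by rewrite -lerBrDl ge_min lexx orbT.
Unshelve. all: by end_near. Qed.

End supergradient.

(** * Antiderivatives of monotone functions *)

Section monotone_antiderivative.
Context {R : realType}.
Local Notation leb := (@lebesgue_measure R).
Implicit Types (f g v : R -> R) (a b x y : R).

Lemma ae_llim_rlim f : nondecreasing f ->
  {ae leb, forall x, llim f x = rlim f x}.
Proof.
move=> ndf.
pose D n := [set x | x \in (`]- n%:R, n%:R[) /\ discontinuity f x].
have cD n : countable (D n).
  by apply: discontinuity_countable => x y _ _; exact: ndf.
have N : leb.-negligible (\bigcup_n D n).
  apply: negligible_bigcup => n; exists (D n); split => //.
  - by apply: countable_measurable => // x; exact: measurable_set1.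
  - exact: countable_lebesgue_measure0.
apply: negligibleS N => x /= /eqP fx.
exists (Num.bound `|x|) => //; split; last first.
  by split => //; [exact: nondecreasing_is_cvg_left|exact:
    nondecreasing_is_cvg_right].
by rewrite in_itv/= -ltr_norml archi_boundP.
Qed.

(* Subdivide [a, b] into n equal parts: the increments of g telescope. *)
Lemma monotone_modulus_cst g v a b : a <= b -> g a <= g b ->
  (forall x y, a <= x -> x <= y -> y <= b ->
    `|v y - v x| <= (y - x) * (g y - g x)) -> v a = v b.
Proof.
move=> ab gab H.
have step n : (0 < n)%N -> `|v b - v a| <= (b - a) * (g b - g a) / n%:R.
  move=> n0; pose h := (b - a) / n%:R.
  have n0' : 0 < n%:R :> R by rewrite ltr0n.
  have h0 : 0 <= h by rewrite divr_ge0 ?subr_ge0// ler0n.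
  have hn : h * n%:R = b - a by rewrite /h divfK// gt_eqF.
  pose x i := a + h * i%:R.
  have xb i : (i <= n)%N -> x i <= b.
    by move=> iN; rewrite /x -lerBrDl -hn ler_wpM2l// ler_nat.
  have ax i : a <= x i by rewrite lerDl mulr_ge0// ler0n.
  have ind i : (i <= n)%N -> `|v (x i) - v a| <= h * (g (x i) - g a).
    elim: i => [_|i IH iN]; first by rewrite /x mulr0 addr0 !subrr normr0 mulr0.
    have xi : x i <= x i.+1 by rewrite /x lerD2l ler_wpM2l// ler_nat.
    have xB : x i.+1 - x i = h by rewrite /x -(natr1 i); ring.
    have := H _ _ (ax i) xi (xb _ iN); rewrite xB => h1.
    have h2 := IH (ltnW iN).
    have -> : v (x i.+1) - v a = (v (x i.+1) - v (x i)) +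
      (v (x i) - v a) by ring.
    rewrite (le_trans (ler_normD _ _))// (le_trans (lerD h1 h2))//.
    by rewrite -mulrDr addrA subrK.
  have := ind n (leqnn n); rewrite /x hn (addrC a) subrK => /le_trans; apply.
  by rewrite /h mulrAC.
apply/eqP; rewrite eq_sym -subr_eq0 -normr_le0; apply/ler_addgt0Pr => e e0;
  rewrite add0r.
pose K := (b - a) * (g b - g a).
have K0 : 0 <= K by rewrite mulr_ge0// subr_ge0.
pose n := (Num.bound (K / e)).
have := archi_boundP (divr_ge0 K0 (ltW e0)); rewrite -/n ltr_pdivrMr// => Kn.
have n0 : (0 < n)%N.
  rewrite lt0n; apply/eqP => n0; move: Kn;
    rewrite n0 mul0r => /(le_lt_trans K0).
  by rewrite ltxx.
by rewrite (le_trans (step n n0))// ler_pdivrMr ?ltr0n// (mulrC e) ltW.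
Qed.

Lemma integrable_nondecreasing g a b : nondecreasing g ->
  leb.-integrable `[a, b] (EFin \o g).
Proof.
move=> ndg; have [ab|ba] := leP a b; last first.
  by rewrite set_itv_ge ?bnd_simp -?ltNge//; exact: integrable_set0.
have lab : (leb `[a, b]%classic < +oo)%E.
  by rewrite lebesgue_measure_itv_bnd// ltry.
apply: (@bounded_integrable _ _ _ _ _ _ (`|g a| + `|g b|)) => //.
- exact: nondecreasing_measurable.
- move=> x /=; rewrite in_itv/= => /andP[/ndg ax /ndg xb].
  have := ler_norm (g b); have := ler_norm (- g a); rewrite normrN.
  have := normr_ge0 (g b); have := normr_ge0 (g a).
  by move=> *; rewrite ler_norml; apply/andP; split; lra.
Qed.

(** On [[x, y]] both the integral of [g] and [v x - v y] lie between [(y - x) * g x] and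
    [(y - x) * g y]. So the increments of their difference obey the modulus of
    [monotone_modulus_cst], and no continuity of [g] is needed. *)
Lemma Rintegral_supergradient g v a b : a <= b -> nondecreasing g ->
  (forall x y, v y <= v x - (y - x) * g x) ->
  \int[leb]_(x in `[a, b]) g x = v a - v b.
Proof.
move=> ab ndg gv.
have ig x y := @integrable_nondecreasing g x y ndg.
pose G y := \int[leb]_(x in `[a, y]) g x + v y.
suff : G a = G b by rewrite /G set_itv1 Rintegral_set1; lra.
apply: (monotone_modulus_cst ab (ndg _ _ ab)) => x y ax xy yb.
have -> : G y - G x = \int[leb]_(z in `[x, y]) g z + (v y - v x).
  rewrite /G -[in RHS]Rintegral_itv_obnd_cbnd; last first.
    by apply: integrableS (ig x y) => //; exact: subset_itv_oc_cc.
  by rewrite -(@Rintegral_itvB _ _ (BLeft a) (BRight y) x) ?bnd_simp//; lra.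
have lebxy : fine (leb `[x, y]) = y - x by rewrite lebesgue_measure_itv_bnd.
have h1 : (y - x) * g x <= \int[leb]_(z in `[x, y]) g z.
  rewrite mulrC -lebxy -Rintegral_cst//; apply: le_Rintegral => //.
    by apply: (@integrable_nondecreasing (cst (g x))).
  by move=> z /=; rewrite in_itv/= => /andP[/ndg].
have h2 : \int[leb]_(z in `[x, y]) g z <= (y - x) * g y.
  rewrite mulrC -lebxy -Rintegral_cst//; apply: le_Rintegral => //.
    by apply: (@integrable_nondecreasing (cst (g y))).
  by move=> z /=; rewrite in_itv/= => /andP[_ /ndg].
move: h1 h2 (gv x y) (gv y x); move: (Rintegral _ _ _) => I.
by rewrite ler_norml; clear => *; apply/andP; split; lra.
Qed.

End monotone_antiderivative.

(** * Test functions and the weak formulation *)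

Section test_function_theory.
Context {R : realType}.
Variable phi : R * R -> R.
Hypothesis tphi : test_function phi.
Implicit Types (x t : R) (p : R * R).

Let K := topological_support phi.

Lemma test_function_continuous : continuous phi.
Proof. by have [/(_ [::])[]] := tphi. Qed.

Lemma partial_continuous b : continuous (partial phi b).
Proof. by have [/(_ [:: b])[]] := tphi. Qed.

Lemma is_derive_partial_x x t :
  is_derive x (1 : R) (fun z => phi (z, t)) (partial phi false (x, t)).
Proof.
have [/(_ [::])[_ /= /(_ (x, t) false)] d _ _] := tphi.
have E : (fun h : R => h^-1 *: ((phi \o shift (x,
  t)) (h *: direction false) - phi (x, t))) =
   (fun h : R => h^-1 *: (((fun z =>
     phi (z, t)) \o shift x) (h *: (1 : R)) - phi (x, t))).
  apply/funext => h /=; congr (_ *: (phi (_, _) - _)).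
  by rewrite /= scaler0 add0r.
split; first by move: d; rewrite /derivable E.
by rewrite /partial /derive -E.
Qed.

Lemma is_derive_partial_t x t :
  is_derive t (1 : R) (fun s => phi (x, s)) (partial phi true (x, t)).
Proof.
have [/(_ [::])[_ /= /(_ (x, t) true)] d _ _] := tphi.
have E : (fun h : R => h^-1 *: ((phi \o shift (x,
  t)) (h *: direction true) - phi (x, t))) =
   (fun h : R => h^-1 *: (((fun z =>
     phi (x, z)) \o shift t) (h *: (1 : R)) - phi (x, t))).
  apply/funext => h /=; congr (_ *: (phi (_, _) - _)).
  by rewrite /= scaler0 add0r.
split; first by move: d; rewrite /derivable E.
by rewrite /partial /derive -E.
Qed.

Lemma test_function_eq0 p : ~ K p -> phi p = 0.
Proof.
move=> Kp; apply/eqP/negP => phip; apply: Kp.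
by apply: subset_closure => /=; apply/negP.
Qed.

Lemma partial_eq0 b p : ~ K p -> partial phi b p = 0.
Proof.
move=> Kp; rewrite /partial (@near_eq_derive _ _ _ _ (cst 0)) ?derive_cst//.
have : open (~` K) by apply: closed_openC; exact: closed_closure.
rewrite openE => /(_ p Kp); apply: filterS => q.
exact: test_function_eq0.
Qed.

Lemma compact_support_bounded (f : R * R -> R) : continuous f ->
  (forall p, ~ K p -> f p = 0) -> exists C : R, forall p, `|f p| <= C.
Proof.
move=> cf f0; have [_ cK _] := tphi.
have : bounded_set (f @` K).
  apply: compact_bounded; apply: continuous_compact => //.
  exact: continuous_subspaceT.
move=> [C [_ /(_ (`|C| + 1))]].
have -> : C < `|C| + 1 by rewrite (le_lt_trans (ler_norm _))// ltrDl.
move=> /(_ isT) fC; exists (`|C| + 1) => p.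
have [Kp|Kp] := pselect (K p); last by rewrite f0// normr0 addr_ge0.
by apply: fC; exists p.
Qed.

Lemma partial_bounded b : exists C : R, forall p, `|partial phi b p| <= C.
Proof.
apply: compact_support_bounded; first exact: partial_continuous.
by move=> p; exact: partial_eq0.
Qed.

Lemma test_function_box : exists c d a b : R, [/\ c < d, 0 < a, a < b &
  forall x t, K (x, t) -> [/\ c < x, x < d, a < t & t < b]].
Proof.
have [_ cK Kpos] := tphi.
have [B KB] : exists B : R, forall p, K p -> `|p| <= B.
  have [B [_ /(_ (B + 1))]] := compact_bounded cK.
  by rewrite ltrDl ltr01 => /(_ isT) h; exists (B + 1) => p /h.
(* A compact subset of the open half-plane stays away from t = 0: the time coordinate attains a
   positive minimum on it. *)
have [a a0 Ka] : exists2 a : R, 0 < a & forall p, K p -> a <= p.2.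
  have [K0|/set0P K0] := eqVneq K set0.
    by exists 1 => // p; rewrite K0.
  have [|p Kp h] := @compact_EVT_min _ _ (fun q : R * R => q.2) K K0 cK.
    by apply: continuous_subspaceT => q; exact: cvg_snd.
  exists p.2; last by move=> q Kq; apply: h; rewrite inE.
  by apply: Kpos; rewrite inE in Kp.
(* Margins that make all inequalities strict; the [a] in the last bound gives [a / 2] below it
   without comparing [a] with [B]. *)
exists (- (`|B| + 1)), (`|B| + 1), (a / 2), (`|B| + a + 1).
have B0 := normr_ge0 B.
split; [lra|lra|lra|] => x t Kxt.
have := KB _ Kxt; have := Ka _ Kxt;
  rewrite /= prod_normE/= ge_max => at_ /andP[].
have BB := ler_norm B.
rewrite !ler_norml => /andP[x1 x2] /andP[t1 t2].
by split; lra.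
Qed.

End test_function_theory.

(** * Integration by parts in space *)

Section by_parts.
Context {R : realType}.
Local Notation leb := (@lebesgue_measure R).
Variables (psi psi' : R -> R) (c d K' : R).
Hypotheses (cd : c < d) (cpsi' : continuous psi')
  (dpsi : forall x, is_derive x (1 : R) psi (psi' x))
  (psi'K : forall x, `|psi' x| <= K')
  (psic : forall x, x <= c -> psi x = 0) (psid : forall x, d <= x -> psi x = 0).

Let cpsi : continuous psi.
Proof.
by move=> x; apply: differentiable_continuous; apply/derivable1_diffP;
  apply: ex_derive.
Qed.

Let lebcd : (leb `[c, d]%classic < +oo)%E.
Proof. by rewrite lebesgue_measure_itv_bnd ?ltry// ltW. Qed.

(** Integration by parts against the Stieltjes measure of [f] itself, whose [field] is that of [f]
    because only one-sided limits enter; the inner integrals are then given by the midpoint chain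
    rule. *)
Lemma drift_by_parts M f : is_cdf M f ->
  \int[stieltjes f]_x (psi x * field M f x) =
  - \int[leb]_(z in `[c, d]) (psi' z * flux M (f z)).
Proof.
move=> cf; have [ndf _ _] := cf.
have fT : (stieltjes f setT < +oo)%E by rewrite (stieltjes_setT cf) ltry.
(* Restricting to [setT] changes no value; it equips the measure with its finiteness. *)
pose nu : {finite_measure set (measurableTypeR R) -> \bar R} :=
  mfrestr measurableT fT.
have nuE A : nu A = stieltjes f A by rewrite /nu /= /mfrestr /mrestr setIT.
have massE : mass nu = M by rewrite /mass nuE (stieltjes_setT cf).
have m0E : m0 nu = llim f.
  by apply/funext => x; rewrite /m0 nuE (stieltjes_itvNyo _ cf).
have fieldE x : field (mass nu) (m0 nu) x = field M f x.
  by rewrite /field llim_m0 rlim_m0 m0E nuE (stieltjes_itvNyc _ cf) massE.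
have -> : \int[stieltjes f]_x (psi x * field M f x) =
    \int[nu]_x (psi x * field (mass nu) (m0 nu) x).
  rewrite /Rintegral; congr fine.
  under [RHS]eq_integral do rewrite fieldE.
  by apply: eq_measure_integral => A _ _; exact/esym/nuE.
have mfield : measurable_fun setT (field (mass nu) (m0 nu)).
  apply: measurable_funM => //; apply: measurable_funB => //.
  by apply: measurable_funD; apply: nondecreasing_measurable => //;
    [exact/llim_nondecreasing/m0_nondecreasing|exact: rlim_m0_nondecreasing].
have fieldM x : `|field (mass nu) (m0 nu) x| <= M.
  rewrite fieldE /field.
  have := is_cdf_llim_le x cf; have := is_cdf_llim_ge0 x cf.
  have := is_cdf_rlim_le x cf; have := is_cdf_rlim_ge0 x cf.
  by move=> *; rewrite ler_norml; apply/andP; split; lra.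
rewrite (@Rintegral_by_parts_measure _ nu (field (mass nu) (m0 nu)) psi psi'
  c d M K')//; last exact: ltW.
congr (- _).
under eq_Rintegral do rewrite Rintegral_field_m0 massE m0E.
rewrite /Rintegral; congr fine.
have mflux g : nondecreasing g -> measurable_fun `[c, d]%classic
    (EFin \o (fun z => psi' z * flux M (g z))).
  move=> ndg; apply/measurable_EFinP; apply: measurable_funM.
    by apply: measurable_funTS; exact: continuous_measurable_fun.
  apply: measurable_funM => //; apply: measurable_funB => //.
    by apply: measurable_funX; exact: nondecreasing_measurable.
  by apply: measurable_funM => //; exact: nondecreasing_measurable.
apply: ae_eq_integral => //.
- by have := mflux _ (llim_nondecreasing ndf).
- by have := mflux _ ndf.
(* The chain rule yields [flux M (llim f x)]; [llim f] and [f] can differ only at jumps of [f]. *)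
- have [N [mN N0 sub]] := ae_llim_rlim ndf; exists N; split => // x /= hx.
  apply: sub => /= lr; apply: hx => _; congr (_ * flux _ _)%:E.
  apply/le_anti; rewrite (llim_le ndf)/= lr.
  exact: (nondecreasing_le_rlim ndf).
Qed.

(** The same formula with Lebesgue measure on [[c, d]] as the finite measure: the integral of [g] up
    to [z] is [v c - v z] by [Rintegral_supergradient]. *)
Lemma lebesgue_by_parts M g v : nondecreasing g -> (forall x, 0 <= g x <= M) ->
  (forall x y, v y <= v x - (y - x) * g x) ->
  \int[leb]_(x in `[c, d]) (psi x * g x) =
  \int[leb]_(x in `[c, d]) (psi' x * v x).
Proof.
move=> ndg gM gv.
have mg (A : set R) : measurable A -> measurable_fun A g.
  by move=> mA; exact: nondecreasing_measurable.
pose I : set (measurableTypeR R) := `[c, d]%classic.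
have mI : measurable I by exact: measurable_itv.
pose nu : {finite_measure set (measurableTypeR R) -> \bar R} :=
  mfrestr mI lebcd.
have gM' x : `|g x| <= M by have /andP[? ?] := gM x; rewrite ger0_norm.
have := @Rintegral_by_parts_measure _ nu g psi psi' c d M K' (ltW cd)
  (mg _ measurableT) gM' cpsi' dpsi psi'K psic psid.
have [C psiC] : exists C : R, forall x, `|psi x| <= C.
  have [|C0 _ h] := @EVT_max R (fun x => `|psi x|) c d (ltW cd).
    apply: continuous_subspaceT => x; apply: continuous_comp; first exact: cpsi.
    exact: norm_continuous.
  exists `|psi C0| => x.
  have [xc|cx] := leP x c; first by rewrite psic// normr0.
  have [dx|xd] := leP d x; first by rewrite psid// normr0.
  by apply: h; rewrite in_itv/= (ltW cx) ltW.
have ipg : nu.-integrable setT (EFin \o (fun x => psi x * g x)).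
  apply: (@bounded_integrable _ _ _ nu setT (fun x => psi x * g x) (C * M)) =>
    //.
  - by rewrite -ge0_fin_numE// fin_num_measure.
  - apply: measurable_funM; last exact: mg.
    exact: continuous_measurable_fun.
  - by move=> x _; rewrite normrM ler_pM.
rewrite {1}/Rintegral integral_mrestr// -/(Rintegral leb I _) => ->.
have vmon : {in `[c, d], forall x, v d <= v x <= v c}.
  move=> x; rewrite in_itv/= => /andP[cx xd]; apply/andP; split.
    apply: le_trans (gv x d) _; rewrite lerBlDr lerDl mulr_ge0 ?subr_ge0//.
    by case/andP: (gM x).
  apply: le_trans (gv c x) _; rewrite lerBlDr lerDl mulr_ge0 ?subr_ge0//.
  by case/andP: (gM c).
have mv : measurable_fun setT v.
  apply: nonincreasing_measurable => // x y xy; apply: le_trans (gv x y) _.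
  rewrite lerBlDr lerDl mulr_ge0 ?subr_ge0//.
  by case/andP: (gM x).
have mpsi' : measurable_fun setT psi' by exact: continuous_measurable_fun.
have K'0 : 0 <= K' := le_trans (normr_ge0 _) (psi'K 0).
have ipsi' : leb.-integrable `[c, d]%classic (EFin \o psi').
  apply: (@bounded_integrable _ _ _ _ _ _ K') => //.
  exact: measurable_funTS.
have ipv : leb.-integrable `[c, d]%classic (EFin \o (fun z => psi' z * v z)).
  apply: (@bounded_integrable _ _ _ _ _ _ (K' * (`|v d| + `|v c|))) => //.
    by apply: measurable_funTS; exact: measurable_funM.
  move=> x xcd; rewrite normrM ler_pM//.
  have /andP := vmon x xcd.
  have := ler_norm (v c); have := ler_norm (- v d); rewrite normrN.
  have := normr_ge0 (v c); have := normr_ge0 (v d).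
  by move=> ? ? ? ? [? ?]; rewrite ler_norml; apply/andP; split; lra.
(* The constant [v c] will drop out, as [psi'] integrates to [psi d - psi c = 0]. *)
transitivity (- \int[leb]_(z in `[c, d]) (v c * psi' z - psi' z * v z)).
  congr (- _); apply: eq_Rintegral => z; rewrite inE/= => zcd.
  rewrite [v c * _]mulrC -mulrBr; congr (_ * _).
  have /andP[cz zd] : c <= z <= d by move: zcd; rewrite in_itv.
  rewrite -(Rintegral_supergradient cz ndg gv).
  have iNy : nu.-integrable `]-oo, z[%classic (EFin \o g).
    apply: (@bounded_integrable _ _ _ nu _ g M) => //.
    - by rewrite -ge0_fin_numE// fin_num_measure.
    - exact: mg.
  have iT : nu.-integrable setT (EFin \o (g \_ `]-oo, z[)).
    rewrite -restrict_EFin; exact/(integrable_mkcond _ _).1.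
  rewrite [LHS]Rintegral_mkcond {1}/Rintegral integral_mrestr//.
  rewrite -/(Rintegral leb I _) -Rintegral_mkcondr.
  rewrite -Rintegral_itv_bndo_bndc; last first.
    apply: integrableS (integrable_nondecreasing c z ndg) => //.
    exact: subset_itv_co_cc.
  congr Rintegral; apply/seteqP; split => x; rewrite /I/= !in_itv/=.
    by move=> [/andP[-> _] ->].
  by move=> /andP[-> xz]; rewrite xz (le_trans (ltW xz)).
rewrite RintegralB//; last exact: integrable_EFinZl.
rewrite RintegralZl// (continuous_Rintegral_derive _ _ dpsi) ?ltW//.
by rewrite (psic (lexx c)) (psid (lexx d)) subrr mulr0 sub0r opprK.
Qed.

End by_parts.

Section sequential_criteria.
Context {R : realType}.
Implicit Types (f E : R -> R) (t l : R).

(** Dominated convergence is sequential and the supergradient inequality holds at nonnegative times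
    only; a tail of any sequence tending to [t] is positive. *)
Lemma cvg_positive_seq f t l : 0 < t ->
  (forall u : nat -> R, (forall n, 0 < u n) -> u n @[n --> \oo] --> t ->
    f (u n) @[n --> \oo] --> l) ->
  f s @[s --> t] --> l.
Proof.
move=> t0 H; apply/(@cvg_nbhsP _ R^o) => u ut.
have [N _ uN] : \forall n \near \oo, 0 < u n by exact: (cvgr_gt _ ut).
rewrite -(cvg_shiftn N); apply: (H (fun n => u (n + N)%N)).
  by move=> n; apply: uN => /=; exact: leq_addl.
by rewrite (cvg_shiftn N).
Qed.

Lemma is_derive_positive_seq E t l : 0 < t ->
  (forall h : nat -> R, (forall n, h n != 0) -> (forall n, 0 < h n + t) ->
    h n @[n --> \oo] --> 0 ->
    (h n)^-1 * (E (h n + t) - E t) @[n --> \oo] --> l) ->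
  is_derive t (1 : R) E l.
Proof.
move=> t0 H.
have cv : h^-1 *: ((E \o shift t) (h *: (1 : R)) - E t) @[h --> 0^'] --> l.
  rewrite (_ : (fun h => _) = (fun h => h^-1 * (E (h + t) - E t))); last first.
    by apply/funext => h /=; rewrite [X in E (X + t)]mulr1.
  apply/cvgr_dnbhsP => h [h0 hcv].
  have ht : h n + t @[n --> \oo] --> t.
    by rewrite -[X in _ --> X]add0r; apply: cvgD => //; exact: cvg_cst.
  have [N _ uN] : \forall n \near \oo, 0 < h n + t by exact: (cvgr_gt _ ht).
  rewrite -(cvg_shiftn N).
  have := H (fun n => h (n + N)%N) (fun n => h0 _).
  apply; last by rewrite (cvg_shiftn N).
  by move=> n; apply: uN => /=; exact: leq_addl.
split; first by apply/cvg_ex; exists l.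
exact: cvg_lim cv.
Qed.

Lemma lipschitz_of_derive f (f' : R -> R) (C : R) :
  (forall x, is_derive x (1 : R) f (f' x)) -> (forall x, `|f' x| <= C) ->
  forall x y, `|f x - f y| <= C * `|x - y|.
Proof.
move=> df f'C x y; wlog yx : x y / y <= x.
  move=> H; have [/H//|/ltW/H] := leP y x.
  by rewrite distrC [in leRHS]distrC.
have cf : {within `[y, x], continuous f}.
  apply: continuous_subspaceT => z; apply: differentiable_continuous.
  by apply/derivable1_diffP; apply: ex_derive.
have [z _ ->] := @MVT_segment R f f' y x yx (fun z _ => df z) cf.
by rewrite normrM ler_wpM2r.
Qed.

End sequential_criteria.

Section supergradient_weak_continuity.
Context {R : realType}.
Variables (M : R) (m V p : R -> R -> R).
Hypothesis m_ge0 : forall x t, 0 <= t -> 0 <= m x t.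
Hypothesis m_le : forall x t, 0 <= t -> m x t <= M.
Hypothesis supergradient : forall x t x' t', 0 <= t -> 0 <= t' ->
  V x' t' <= V x t - (x' - x) * m x t - (t' - t) * flux M (m x t).
Hypothesis m_init : is_cdf M (m ^~ 0).
Implicit Types t : R.
(** [p] stands for [mbar rho0], which agrees with [mext rho0] at positive times; the value of [m] at
    t = 0 is the initial datum. *)
Hypothesis pE : forall t, 0 < t -> p ^~ t = m ^~ t.

Let Ep t : 0 < t -> stieltjes (p ^~ t) = stieltjes (m ^~ t).
Proof. by move=> t0; congr stieltjes; exact: pE. Qed.

Lemma supergradient_weak_cvg_nbhs t : 0 < t ->
  weak_cvg_measure (nbhs t) (fun t => stieltjes (p ^~ t)) (stieltjes (p ^~ t)).
Proof.
move=> t0 psi cpsi bpsi; apply: cvg_positive_seq => // u u0 ut.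
rewrite (Ep t0); under eq_fun do rewrite (Ep (u0 _)).
exact: (supergradient_weak_cvg m_ge0 m_le supergradient m_init (ltW t0)
  (fun n => ltW (u0 n)) ut cpsi bpsi).
Qed.

Lemma supergradient_weak_cvg_at_right :
  weak_cvg_measure (0 : R)^'+ (fun t =>
    stieltjes (p ^~ t)) (stieltjes (m ^~ 0)).
Proof.
move=> psi cpsi bpsi; apply/cvg_at_rightP => u [u0 ut].
under eq_fun do rewrite (Ep (u0 _)).
exact: (supergradient_weak_cvg m_ge0 m_le supergradient m_init (lexx 0)
  (fun n => ltW (u0 n)) ut cpsi bpsi).
Qed.

End supergradient_weak_continuity.

(** * The integral identity for a test function *)

Section weak_formulation.
Context {R : realType}.
Variables (M : R) (m V : R -> R -> R).
Hypothesis m_ge0 : forall x t, 0 <= t -> 0 <= m x t.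
Hypothesis m_le : forall x t, 0 <= t -> m x t <= M.
Hypothesis supergradient : forall x t x' t', 0 <= t -> 0 <= t' ->
  V x' t' <= V x t - (x' - x) * m x t - (t' - t) * flux M (m x t).
Hypothesis m_init : is_cdf M (m ^~ 0).
Variable phi : R * R -> R.
Hypothesis tphi : test_function phi.
Variables c d a b : R.
Hypotheses (cd : c < d) (a0 : 0 < a) (ab : a < b).
Hypothesis box : forall x t, topological_support phi (x, t) ->
  [/\ c < x, x < d, a < t & t < b].
Local Notation leb := (@lebesgue_measure R).
Implicit Types x t s : R.

Let phix x t := partial phi false (x, t).
Let phit x t := partial phi true (x, t).

Let ndm t : 0 <= t -> nondecreasing (m ^~ t).
Proof. exact: (supergradient_nondecreasing m_ge0 m_le supergradient). Qed.

Let M0 : 0 <= M. Proof. exact: is_cdf_mass_ge0 m_init. Qed.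

Let lebcd : (leb `[c, d]%classic < +oo)%E.
Proof. by rewrite lebesgue_measure_itv_bnd ?ltry// ltW. Qed.

Let outside_x x t : x <= c \/ d <= x -> ~ topological_support phi (x, t).
Proof. by move=> h /box[? ? _ _]; lra. Qed.

Let outside_t x t : t <= a \/ b <= t -> ~ topological_support phi (x, t).
Proof. by move=> h /box[_ _ ? ?]; lra. Qed.

Let slice_x (f : R * R -> R) t : continuous f -> continuous (fun x => f (x, t)).
Proof.
move=> cf x; apply: (continuous_cvg _ (cf (x, t))).
have := @cvg_pair _ _ _ (nbhs x) (nbhs x) (nbhs t) _ _ _ id (fun=> t) cvg_id
  (cvg_cst t).
exact.
Qed.

Let slice_seq (f : R * R -> R) x t (u : nat -> R) : continuous f ->
  u n @[n --> \oo] --> t -> f (x, u n) @[n --> \oo] --> f (x, t).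
Proof.
move=> cf ut; apply: (continuous_cvg _ (cf (x, t))).
have := @cvg_pair _ _ _ \oo (nbhs x) (nbhs t) _ _ _ (fun=> x) u (cvg_cst x) ut.
exact.
Qed.

Let flux_le w : 0 <= w -> w <= M -> `|flux M w| <= M ^+ 2.
Proof. by move=> w0 wM; rewrite /flux ler_norml; apply/andP; split; nra. Qed.

Let m_cvg (u : nat -> R) t : 0 <= t -> (forall n, 0 <= u n) ->
  u n @[n --> \oo] --> t ->
  {ae leb, forall x, `[c, d]%classic x -> m x (u n) @[n --> \oo] --> m x t}.
Proof.
move=> t0 u0 ut; have [N [mN N0 sub]] := ae_llim_rlim (ndm t0).
exists N; split => // x /= hx; apply: sub => /= lr; apply: hx => _.
exact: (supergradient_cvg m_ge0 m_le supergradient m_init).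
Qed.

Let mslice (f : R * R -> R) t (g : R -> R) : continuous f ->
  measurable_fun `[c, d]%classic g ->
  measurable_fun `[c, d]%classic (fun x => f (x, t) * g x).
Proof.
move=> cf mg; apply: measurable_funM => //; apply: measurable_funTS.
by apply: continuous_measurable_fun; exact: slice_x.
Qed.

Let mm t : 0 <= t -> measurable_fun `[c, d]%classic (m ^~ t).
Proof. by move=> t0; apply: nondecreasing_measurable => //; exact: ndm. Qed.

Let mflux t : 0 <= t -> measurable_fun `[c, d]%classic (fun x =>
  flux M (m x t)).
Proof.
move=> t0; apply: measurable_funM => //; apply: measurable_funB => //.
  by apply: measurable_funX; exact: mm.
by apply: measurable_funM => //; exact: mm.
Qed.

Let flux_cvg (F : set_system nat) {FF : Filter F} (u : nat -> R) w :
  u n @[n --> F] --> w -> flux M (u n) @[n --> F] --> flux M w.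
Proof.
move=> uw; apply: cvgM; last exact: cvg_cst.
apply: cvgB; first by rewrite expr2; under eq_fun do rewrite expr2; exact: cvgM.
by apply: cvgM => //; exact: cvg_cst.
Qed.

(* D is minus the drift term, see drift_by_parts. *)
Let T t := \int[leb]_(x in `[c, d]) (phit x t * m x t).
Let D t := \int[leb]_(x in `[c, d]) (phix x t * flux M (m x t)).
Let E t := \int[leb]_(x in `[c, d]) (phi (x, t) * m x t).

Let T_continuous t : 0 < t -> T s @[s --> t] --> T t.
Proof.
move=> t0; have [C phiC] := partial_bounded tphi true.
apply: cvg_positive_seq => // u u0 ut.
have u0' n : 0 <= u n := ltW (u0 n).
apply: (@bounded_cvg_Rintegral _ _ _ leb _ _ _ (C * M)) => //.
- by move=> n; apply: mslice; [exact: partial_continuous|exact: (mm (u0' n))].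
- by apply: mslice; [exact: partial_continuous|exact: (mm (ltW t0))].
- have [N [mN N0 sub]] := m_cvg (ltW t0) u0' ut.
  exists N; split => // x /= hx; apply: sub => /= mx; apply: hx => xcd.
  apply: cvgM; last exact: mx.
  by apply: (@slice_seq (partial phi true)) => //; exact: partial_continuous.
- move=> n x _; rewrite normrM ler_pM// ?phiC//.
  by rewrite ger0_norm ?m_le ?m_ge0 ?u0'.
Qed.

Let D_continuous t : 0 < t -> D s @[s --> t] --> D t.
Proof.
move=> t0; have [C phiC] := partial_bounded tphi false.
apply: cvg_positive_seq => // u u0 ut.
have u0' n : 0 <= u n := ltW (u0 n).
apply: (@bounded_cvg_Rintegral _ _ _ leb _ _ _ (C * M ^+ 2)) => //.
- by move=> n; apply: mslice; [exact: partial_continuous|exact: (mflux (u0'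
  n))].
- by apply: mslice; [exact: partial_continuous|exact: (mflux (ltW t0))].
- have [N [mN N0 sub]] := m_cvg (ltW t0) u0' ut.
  exists N; split => // x /= hx; apply: sub => /= mx; apply: hx => xcd.
  apply: cvgM; last by apply: flux_cvg; exact: mx.
  by apply: (@slice_seq (partial phi false)) => //; exact: partial_continuous.
- move=> n x _; rewrite normrM ler_pM// ?phiC//.
  by rewrite flux_le ?m_le ?m_ge0 ?u0'.
Qed.

(** Two times are needed: the product rule in [increment_quotient] pairs the test function at one
    time with the slice at another. *)
Let by_parts_m t s : 0 <= s -> \int[leb]_(x in `[c, d]) (phi (x, t) * m x s) =
  \int[leb]_(x in `[c, d]) (phix x t * V x s).
Proof.
move=> s0; have [C phiC] := partial_bounded tphi false.
apply: (@lebesgue_by_parts _ (fun x =>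
  phi (x, t)) (phix ^~ t) c d C cd _ _ _ _ _ M
  (m ^~ s) (V ^~ s)).
- by apply: (@slice_x (partial phi false)); exact: partial_continuous.
- by move=> x; exact: is_derive_partial_x.
- by move=> x; exact: phiC.
- by move=> x xc; apply: test_function_eq0 => //; apply: outside_x; left.
- by move=> x xd; apply: test_function_eq0 => //; apply: outside_x; right.
- exact: ndm.
- by move=> x; rewrite m_ge0 ?m_le.
- by move=> x y; have := supergradient x y s0 s0; rewrite subrr mul0r subr0.
Qed.

Let quotient x t h : R := h^-1 * (V x (h + t) - V x t).

(** The inequality used at both ends of the time step gives [- h * f1 <= v1 - v0 <= - h * f0], with
    [f0], [f1] the fluxes at the two times. Hence the time derivative of [V] is [- flux] wherever
    the flux is continuous in time. *)
Let quotient_dist x t h : 0 <= t -> 0 <= h + t -> h != 0 ->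
  `|quotient x t h + flux M (m x t)| <=
  `|flux M (m x (h + t)) - flux M (m x t)|.
Proof.
move=> t0 ht0 h0.
have := supergradient x x t0 ht0; have := supergradient x x ht0 t0.
rewrite /quotient subrr !mul0r !subr0 addrK opprD addrCA subrr addr0.
move: (V x t) (V x (h + t)) (flux M (m x t)) (flux M (m x (h + t))).
move=> v0 v1 f0 f1 h1 h2.
have -> : h^-1 * (v1 - v0) + f0 = h^-1 * (v1 - v0 + h * f0).
  by rewrite [in RHS]mulrDr mulKf.
rewrite normrM normfV ler_pdivrMl ?normr_gt0// -normrM.
by rewrite [X in X <= _]ler0_norm ?[X in _ <= X]ger0_norm; lra.
Qed.

Let V_nonincreasing s : 0 <= s -> nonincreasing_fun (V ^~ s).
Proof.
move=> s0 x y xy; have := supergradient x y s0 s0.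
rewrite subrr mul0r subr0 => /le_trans; apply.
by rewrite gerBl mulr_ge0 ?subr_ge0// m_ge0.
Qed.

Let integrable_V t s : 0 <= s ->
  leb.-integrable `[c, d]%classic (EFin \o (fun x => phix x t * V x s)).
Proof.
move=> s0; have [C phiC] := partial_bounded tphi false.
apply: (@bounded_integrable _ _ _ leb _ (fun x => phix x t * V x s)
  (C * (`|V d s| + `|V c s|))) => //.
- apply: mslice; first exact: partial_continuous.
  by apply: nonincreasing_measurable => //; exact: V_nonincreasing.
- move=> x; rewrite /= in_itv/= => /andP[cx xd]; rewrite normrM ler_pM ?phiC//.
  have := V_nonincreasing s0 cx; have := V_nonincreasing s0 xd.
  have := ler_norm (V c s); have := ler_norm (- V d s); rewrite normrN.
  have := normr_ge0 (V c s); have := normr_ge0 (V d s).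
  by move=> *; rewrite ler_norml; apply/andP; split; lra.
Qed.

Let integrable_m (f : R * R -> R) t s : continuous f ->
  (forall p, ~ topological_support phi p -> f p = 0) -> 0 <= s ->
  leb.-integrable `[c, d]%classic (EFin \o (fun x => f (x, t) * m x s)).
Proof.
move=> cf f0 s0; have [C fC] := compact_support_bounded tphi cf f0.
apply: (@bounded_integrable _ _ _ leb _ (fun x => f (x, t) * m x s) (C * M)) =>
  //.
- by apply: mslice => //; exact: mm.
- by move=> x _; rewrite normrM ler_pM// ger0_norm ?m_le ?m_ge0.
Qed.

(** Discrete product rule. The quotient of [m] in time, which need not converge, is traded through
    [by_parts_m] for the quotient of [V], which [quotient_dist] controls. *)
Let increment_quotient t h : 0 < t -> 0 < h + t ->
  h^-1 * (E (h + t) - E t) =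
  \int[leb]_(x in `[c, d]) (h^-1 * (phi (x, h + t) - phi (x, t)) * m x (h +
    t)) +
  \int[leb]_(x in `[c, d]) (phix x t * quotient x t h).
Proof.
move=> t0 ht0; set s := h + t; have t0' := ltW t0; have s0 := ltW ht0.
have cphi := test_function_continuous tphi.
have phi0 := test_function_eq0 (phi := phi).
have -> : \int[leb]_(x in `[c, d]) (h^-1 * (phi (x, s) - phi (x, t)) * m x s) =
    h^-1 * (E s - \int[leb]_(x in `[c, d]) (phi (x, t) * m x s)).
  rewrite /E -RintegralB//; [|exact: integrable_m|exact: integrable_m].
  rewrite -RintegralZl//; last by apply: integrable_EFinB => //;
    exact: integrable_m.
  by apply: eq_Rintegral => x _; rewrite -mulrA mulrBl.
have -> : \int[leb]_(x in `[c, d]) (phix x t * quotient x t h) =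
    h^-1 * (\int[leb]_(x in `[c, d]) (phi (x, t) * m x s) - E t).
  rewrite /E !by_parts_m// -RintegralB//;
    [|exact: integrable_V|exact: integrable_V].
  rewrite -RintegralZl//; last by apply: integrable_EFinB => //;
    exact: integrable_V.
  by apply: eq_Rintegral => x _; rewrite /quotient -mulrBr mulrCA.
by rewrite -mulrDr addrA subrK.
Qed.

Let derive_E t : 0 < t -> is_derive t (1 : R) E (T t - D t).
Proof.
move=> t0; have t0' := ltW t0; apply: is_derive_positive_seq => // h h0 ht0 hcv.
have ht0' n : 0 <= h n + t := ltW (ht0 n).
under eq_fun do rewrite increment_quotient//.
have htcv : h n + t @[n --> \oo] --> t.
  by rewrite -[X in _ --> X]add0r; apply: cvgD => //; exact: cvg_cst.
have cphi := test_function_continuous tphi.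
apply: cvgD.
- have [C phiC] := partial_bounded tphi true.
  apply: (@bounded_cvg_Rintegral _ _ _ leb _ _ _ (C * M)) => //.
  + move=> n; apply: measurable_funM; last exact: (mm (ht0' n)).
    apply: measurable_funM => //; apply: measurable_funTS.
    by apply: measurable_funB; apply: continuous_measurable_fun; exact: slice_x.
  + by apply: mslice; [exact: partial_continuous|exact: mm].
  + have [N [mN N0 sub]] := m_cvg t0' ht0' htcv.
    exists N; split => // x /= hx; apply: sub => /= mx; apply: hx => xcd.
    apply: cvgM; last exact: mx.
    have [dphi phitE] := is_derive_partial_t tphi x t.
    move: dphi => /cvg_ex[l dl].
    have -> : phit x t = l by rewrite /phit -phitE /derive (cvg_lim _ dl).
    move/cvgr_dnbhsP : dl => /(_ h (conj h0 hcv)) /=.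
    by under eq_fun do rewrite [X in phi (_, X + t)]mulr1.
  + move=> n x _; rewrite normrM ler_pM//;
    last by rewrite ger0_norm ?m_le ?m_ge0.
    (* Domination: by the mean value theorem, time quotients of [phi] are bounded by the bound [C]
       of its time derivative. *)
    rewrite normrM normfV ler_pdivrMl ?normr_gt0// mulrC.
    have dphi s := is_derive_partial_t tphi x s.
    rewrite -{2}[h n](addrK t).
    have := @lipschitz_of_derive _ (fun s => phi (x, s)) (phit x) C dphi
      (fun s => phiC (x, s)) (h n + t) t.
    exact.
- have -> : - D t = \int[leb]_(x in `[c, d]) (phix x t * - flux M (m x t)).
    under [RHS]eq_Rintegral do rewrite mulrN -mulN1r.
    rewrite RintegralZl// ?mulN1r//.
    have [C phiC] := partial_bounded tphi false.
    apply: (@bounded_integrable _ _ _ leb _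
      (fun x => phix x t * flux M (m x t)) (C * M ^+ 2)) => //.
      by apply: mslice; [exact: partial_continuous|exact: mflux].
    by move=> x _; rewrite normrM ler_pM ?phiC// flux_le ?m_le ?m_ge0.
  have [C phiC] := partial_bounded tphi false.
  (* [quotient_dist] bounds the quotient by one flux plus the difference of two, each of size at
     most [M ^+ 2]. *)
  apply: (@bounded_cvg_Rintegral _ _ _ leb _ _ _ (C * (3 * M ^+ 2))) => //.
  + move=> n; apply: mslice; first exact: partial_continuous.
    apply: measurable_funM => //; apply: measurable_funB;
      by apply: nonincreasing_measurable => //; exact: V_nonincreasing.
  + apply: mslice; first exact: partial_continuous.
    by apply: measurable_funN; exact: mflux.
  + have [N [mN N0 sub]] := m_cvg t0' ht0' htcv.
    exists N; split => // x /= hx; apply: sub => /= mx; apply: hx => xcd.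
    apply: cvgM; first exact: cvg_cst.
    apply/cvgrPdist_le => e e0.
    have fc : flux M (m x (h n + t)) @[n --> \oo] --> flux M (m x t).
      by apply: flux_cvg; exact: mx.
    move/cvgrPdist_le : fc => /(_ _ e0); apply: filterS => n.
    rewrite distrC => /(le_trans (quotient_dist x t0' (ht0' n) (h0 n))).
    by rewrite -opprD normrN addrC.
  + move=> n x _; rewrite normrM ler_pM ?phiC//.
    have := quotient_dist x t0' (ht0' n) (h0 n).
    have := flux_le (m_ge0 x t0') (m_le x t0').
    have := flux_le (m_ge0 x (ht0' n)) (m_le x (ht0' n)).
    move: (flux _ _) (flux _ _) (quotient _ _ _) (M ^+ 2) => f0 f1 q M2.
    rewrite !ler_norml => /andP[? ?] /andP[? ?].
    have [f10|f10] := lerP 0 (f1 - f0).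
      by rewrite ger0_norm// => /andP[? ?]; apply/andP; split; lra.
    by rewrite ltr0_norm// => /andP[? ?]; apply/andP; split; lra.
Qed.

Let restrict_positive (f : R -> R) : (forall t, t <= a \/ b <= t -> f t = 0) ->
  (f \_ `]0, +oo[ = f \_ `[a, b])%classic.
Proof.
move=> f0; apply/funext => t; rewrite !patchE.
case: ifPn; rewrite ?inE ?notin_setE/= in_itv/= ?andbT.
  move=> t0; case: ifPn => //; rewrite notin_setE/= in_itv/=.
  by move=> /negP; rewrite negb_and -!ltNge => /orP[/ltW h|/ltW h];
    apply: f0; [left|right].
move=> /negP; rewrite -leNgt => t0; case: ifPn => //.
rewrite inE/= in_itv/= => /andP[at_ _].
by have := lt_le_trans a0 (le_trans at_ t0); rewrite ltxx.
Qed.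

Let continuous_positive (f : R -> R) : (forall t, 0 < t ->
  f s @[s --> t] --> f t) ->
  {within `[a, b], continuous f}.
Proof.
move=> cf; apply/continuous_in_subspaceT => t.
rewrite inE/= in_itv/= => /andP[at_ _]; apply: cf; exact: lt_le_trans at_.
Qed.

Let integrable_positive (f : R -> R) : (forall t, t <= a \/ b <= t -> f t =
  0) ->
  (forall t, 0 < t -> f s @[s --> t] --> f t) ->
  leb.-integrable `]0, +oo[%classic (EFin \o f).
Proof.
move=> f0 cf; apply/(integrable_mkcond _ _).2 => //.
rewrite restrict_EFin restrict_positive// -restrict_EFin.
apply/(integrable_mkcond _ _).1 => //.
apply: continuous_compact_integrable; first exact: segment_compact.
exact: continuous_positive.
Qed.

Let T_eq0 t : t <= a \/ b <= t -> T t = 0.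
Proof.
move=> h; rewrite /T (@eq_Rintegral _ _ _ _ _ (cst 0)) ?Rintegral_cst ?mul0r//.
by move=> x _; rewrite /phit partial_eq0 ?mul0r//; exact: outside_t.
Qed.

Let D_eq0 t : t <= a \/ b <= t -> D t = 0.
Proof.
move=> h; rewrite /D (@eq_Rintegral _ _ _ _ _ (cst 0)) ?Rintegral_cst ?mul0r//.
by move=> x _; rewrite /phix partial_eq0 ?mul0r//; exact: outside_t.
Qed.

Let E_eq0 t : t <= a \/ b <= t -> E t = 0.
Proof.
move=> h; rewrite /E (@eq_Rintegral _ _ _ _ _ (cst 0)) ?Rintegral_cst ?mul0r//.
by move=> x _; rewrite test_function_eq0 ?mul0r//; exact: outside_t.
Qed.

(** Abstract [f] and [g], prescribed at positive times only, let this apply to the terms written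
    with [mbar], which is known to equal [m] only there. *)
Lemma weak_formulation_box (f g : R -> R) :
  (forall t, 0 < t -> f t = \int[leb]_x (partial phi true (x, t) * m x t)) ->
  (forall t, 0 < t -> g t =
    \int[stieltjes (m ^~ t)]_x (phi (x, t) * field M (m ^~ t) x)) ->
  [/\ leb.-integrable `]0, +oo[%classic (EFin \o f),
      leb.-integrable `]0, +oo[%classic (EFin \o g) &
      \int[leb]_(t in `]0, +oo[%classic) f t
      + \int[leb]_(t in `]0, +oo[%classic) g t = 0].
Proof.
move=> fE gE.
have fT : {in `]0, +oo[%classic, f =1 T}.
  move=> t; rewrite inE/= in_itv/= andbT => t0; rewrite fE// /T.
  rewrite [in RHS]Rintegral_mkcond; apply: eq_Rintegral => x _.
  rewrite patchE; case: ifPn => //; rewrite notin_setE/= in_itv/= => xcd.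
  rewrite partial_eq0 ?mul0r//; apply: outside_x.
  by move/negP : xcd; rewrite negb_and -!ltNge => /orP[/ltW|/ltW]; [left|right].
have gD : {in `]0, +oo[%classic, g =1 (fun t => - D t)}.
  move=> t; rewrite inE/= in_itv/= andbT => t0; rewrite gE// /D.
  have [C phiC] := partial_bounded tphi false.
  apply: (@drift_by_parts _ (fun x => phi (x, t)) (phix ^~ t) c d C cd).
  - by apply: (@slice_x (partial phi false)); exact: partial_continuous.
  - by move=> x; exact: is_derive_partial_x.
  - by move=> x; exact: phiC.
  - by move=> x xc; apply: test_function_eq0 => //; apply: outside_x; left.
  - by move=> x xd; apply: test_function_eq0 => //; apply: outside_x; right.
  - exact: (supergradient_is_cdf m_ge0 m_le supergradient m_init (ltW t0)).
have ND_eq0 t : t <= a \/ b <= t -> - D t = 0 by move=> /D_eq0 ->;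
  rewrite oppr0.
have cND t : 0 < t -> - D s @[s --> t] --> - D t.
  by move=> t0; apply: cvgN; exact: D_continuous.
have iT : leb.-integrable `]0, +oo[%classic (EFin \o T).
  by apply: integrable_positive => //; exact: T_eq0.
have iD : leb.-integrable `]0, +oo[%classic (EFin \o (fun t => - D t)).
  exact: integrable_positive.
split.
- by apply: eq_integrable iT => // t tP /=; rewrite fT.
- by apply: eq_integrable iD => // t tP /=; rewrite gD.
have -> : \int[leb]_(t in `]0, +oo[%classic) f t =
    \int[leb]_(t in `]0, +oo[%classic) T t by exact: eq_Rintegral.
have -> : \int[leb]_(t in `]0, +oo[%classic) g t =
    \int[leb]_(t in `]0, +oo[%classic) (- D t) by exact: eq_Rintegral.
rewrite -RintegralD//.
rewrite Rintegral_mkcond restrict_positive; last first.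
  by move=> t h; rewrite T_eq0// D_eq0// subrr.
(* The integrand is the derivative of [E], which vanishes at both ends of the time box. *)
rewrite -Rintegral_mkcond /Rintegral (@continuous_FTC2 _ _ E)//.
- have -> : E a = 0 by apply: E_eq0; left.
  have -> : E b = 0 by apply: E_eq0; right.
  by rewrite /= subrr.
- apply: continuous_positive => t t0; apply: cvgD; first exact: T_continuous.
  exact: cND.
- have cE t : 0 < t -> E s @[s --> t] --> E t.
    move=> t0; apply: differentiable_continuous; apply/derivable1_diffP.
    by have [] := derive_E t0.
  split.
  + move=> t; rewrite in_itv/= => /andP[at_ _].
    by have [] := derive_E (lt_trans a0 at_).
  + by apply: cvg_at_right_filter; exact: cE.
  + by apply: cvg_at_left_filter; apply: cE; exact: lt_trans ab.
- move=> t; rewrite in_itv/= => /andP[at_ _].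
  have [_ dE] := derive_E (lt_trans a0 at_).
  by rewrite derive1E dE.
Qed.

End weak_formulation.

(** * The functional Fbar and its minimizers *)

Section potential.
Context {R : realType}.
Variable rho0 : {finite_measure set (measurableTypeR R) -> \bar R}.
Hypothesis hF : Fbar_well_defined rho0.
Implicit Types x t y z a b e : R.
Local Notation M := (mass rho0).
Local Notation m := (m0 rho0).
Local Notation F := (Fbar rho0).
Local Notation nu := (nubar rho0).

Let ndm : nondecreasing m. Proof. exact: m0_nondecreasing. Qed.

Let M0 : 0 <= M. Proof. exact: is_cdf_mass_ge0 (m0_is_cdf rho0). Qed.

Lemma mtilde0_bound y : `|mtilde0 rho0 y| <= M / 2.
Proof.
rewrite /mtilde0 /field llim_m0.
have := m0_ge0 rho0 y; have := m0_le_mass rho0 y.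
have := is_cdf_rlim_le y (m0_is_cdf rho0).
have := is_cdf_rlim_ge0 y (m0_is_cdf rho0).
by move=> *; rewrite ler_norml; apply/andP; split; lra.
Qed.

Lemma integrable_mtilde0 (A : set R) : measurable A ->
  rho0.-integrable A (EFin \o mtilde0 rho0).
Proof.
move=> mA; apply: (@bounded_integrable _ _ _ rho0 A (mtilde0 rho0) (M / 2)) =>
  //.
- by rewrite -ge0_fin_numE// fin_num_measure.
- apply: measurable_funTS; apply: measurable_funM => //.
  apply: measurable_funB => //; apply: measurable_funD;
    apply: nondecreasing_measurable => //.
    exact: llim_nondecreasing.
  exact: rlim_m0_nondecreasing.
- by move=> y _; exact: mtilde0_bound.
Qed.

Lemma integrable_integrandF x t y :
  rho0.-integrable `]-oo, y[%classic (EFin \o integrandF rho0 x t).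
Proof.
have mI : measurable (`]-oo, y[%classic : set (measurableTypeR R)).
  exact: measurable_itv.
(* [hF] covers positive times only. Every other [(x, t)], t = 0 included, differs from the reference
   point (0, 1) by a bounded integrand. *)
have -> : integrandF rho0 x t = (fun z =>
    integrandF rho0 0 1 z + ((1 - t) * mtilde0 rho0 z + cst (- x) z)).
  by apply/funext => z; rewrite /integrandF /=; ring.
apply: integrable_EFinD => //; first exact: (hF 0 y ltr01).
apply: integrable_EFinD => //; last exact: integrable_cst_finite.
apply: integrable_EFinZl => //; exact: integrable_mtilde0.
Qed.

Lemma Fbar_affine x t x' t' y :
  F x' t' y = F x t y - (x' - x) * m y - (t' - t) * flux M (m y).
Proof.
have mI : measurable (`]-oo, y[%classic : set (measurableTypeR R)).
  exact: measurable_itv.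
rewrite /Fbar.
under eq_Rintegral => z _.
  rewrite (_ : _ z = integrandF rho0 x t z +
      ((t - t') * mtilde0 rho0 z + cst (x - x') z)); last first.
    by rewrite /integrandF /=; ring.
  over.
have i1 := integrable_integrandF x t y.
have i2 : rho0.-integrable `]-oo, y[%classic
    (EFin \o (fun z => (t - t') * mtilde0 rho0 z)).
  by apply: integrable_EFinZl => //; exact: integrable_mtilde0.
have i3 : rho0.-integrable `]-oo, y[%classic (EFin \o cst (x - x')).
  exact: integrable_cst_finite.
rewrite RintegralD//; last exact: integrable_EFinD.
rewrite (@RintegralD _ _ _ rho0 _ (fun z => (t - t') * mtilde0 rho0 z)
  (cst (x - x')))// RintegralZl//; last exact: integrable_mtilde0.
rewrite Rintegral_cst// -/(m y) /mtilde0 Rintegral_field_m0; ring.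
Qed.

Lemma FbarB x t a b : a <= b ->
  F x t b - F x t a = \int[rho0]_(z in `[a, b[) integrandF rho0 x t z.
Proof.
move=> ab; rewrite /Fbar.
have E : `]-oo, b[%classic = `]-oo, a[ `|` `[a, b[ :> set R.
  apply/seteqP; split => z /=; rewrite !in_itv/=.
    by move=> zb; have [za|az] := ltP z a; [left|right].
  by move=> [/lt_le_trans|/andP[]//]; exact.
rewrite [in X in X - _]E Rintegral_setU//.
- by rewrite addrC addKr.
- by rewrite -E; exact: integrable_integrandF.
- apply/disj_setPS => z /= []; rewrite !in_itv/= => za /andP[az _].
  by have := lt_le_trans za az; rewrite ltxx.
Qed.

(* On [a, b[ the integrand lies between a - x - tM/2 and b - x + tM/2. *)
Lemma FbarB_bounds x t a b : 0 <= t -> a <= b ->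
  (a - x - t * (M / 2)) * (m b - m a) <= F x t b - F x t a <=
  (b - x + t * (M / 2)) * (m b - m a).
Proof.
move=> t0 ab; rewrite FbarB//.
have mI : measurable (`[a, b[%classic : set (measurableTypeR R)).
  exact: measurable_itv.
have rI : fine (rho0 `[a, b[%classic) = m b - m a by rewrite measure_itvco.
have iI : rho0.-integrable `[a, b[%classic (EFin \o integrandF rho0 x t).
  apply: integrableS (integrable_integrandF x t b) => //.
  by move=> z /=; rewrite !in_itv/= => /andP[].
have bd z : `|t * mtilde0 rho0 z| <= t * (M / 2).
  by rewrite normrM ger0_norm// ler_wpM2l// mtilde0_bound.
apply/andP; split; rewrite -rI -Rintegral_cst//; apply: le_Rintegral => //;
  try exact: integrable_cst_finite; move=> z /=;
    rewrite in_itv/= => /andP[az zb];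
  have := bd z; rewrite ler_norml => /andP[? ?]; rewrite /integrandF; lra.
Qed.

(** No mass lies between [a] and [b]. This allows sliding along plateaus of [m0] to reach the
    support. *)
Lemma Fbar_eq x t a b : 0 <= t -> m a = m b -> F x t a = F x t b.
Proof.
wlog ab : a b / a <= b.
  by move=> H; have [/H//|/ltW/H] := leP a b => h t0 mab; rewrite h.
by move=> t0 mab; have := FbarB_bounds x t0 ab; rewrite mab subrr !mulr0; lra.
Qed.

Lemma Fbar_has_lbound x t : 0 <= t -> has_lbound (range (F x t)).
Proof.
move=> t0; pose Y := x + t * (M / 2).
have K0 : 0 <= t * (M / 2) by rewrite mulr_ge0// divr_ge0.
(* Right of [Y] the integrand is nonnegative; on [[y, Y[] it is at most [t * M], so [F] is below its
   value at [Y] by at most [t * M * M]. *)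
exists (F x t Y - (t * (M / 2)) *+ 2 * M) => _ [y _ <-].
have [Yy|/ltW yY] := leP Y y.
  have /andP[+ _] := FbarB_bounds x t0 Yy.
  have -> : Y - x - t * (M / 2) = 0 by rewrite /Y; ring.
  rewrite mul0r subr_ge0; apply: le_trans.
  by rewrite gerBl mulr_ge0// mulrn_wge0.
have /andP[_] := FbarB_bounds x t0 yY.
have -> : Y - x + t * (M / 2) = (t * (M / 2)) *+ 2 by rewrite /Y; ring.
move=> h; suff : (t * (M / 2)) *+ 2 * (m Y - m y) <= (t * (M / 2)) *+ 2 * M by
  lra.
rewrite ler_wpM2l ?mulrn_wge0//.
by have := m0_ge0 rho0 y; have := m0_le_mass rho0 Y; lra.
Qed.

Lemma nubar_le x t y : 0 <= t -> nu x t <= F x t y.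
Proof. by move=> t0; apply: ge_inf; [exact: Fbar_has_lbound|exists y]. Qed.

Lemma nubar_adherent x t e : 0 <= t -> 0 < e -> exists y, F x t y < nu x t + e.
Proof.
move=> t0 e0; have [|_ [y _ <-] h] := @inf_adherent _ (range (F x t)) _ e0.
  by split; [exists (F x t 0), 0|exact: Fbar_has_lbound].
by exists y.
Qed.

(** Each [y n] gives an affine function above [nubar]; along a minimizing sequence these converge to
    one that touches [nubar] at [(x, t)], even if no minimizer exists. *)
Lemma nubar_supergradient (y : nat -> R) x t x' t' w : 0 <= t -> 0 <= t' ->
  F x t (y n) @[n --> \oo] --> nu x t -> m (y n) @[n --> \oo] --> w ->
  nu x' t' <= nu x t - (x' - x) * w - (t' - t) * flux M w.
Proof.
move=> t0 t'0 Fy my.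
have cv : F x' t' (y n) @[n --> \oo] -->
    nu x t - (x' - x) * w - (t' - t) * flux M w.
  under eq_fun do rewrite (Fbar_affine x t).
  apply: cvgB; first by apply: cvgB => //; apply: cvgM => //; exact: cvg_cst.
  apply: cvgM; first exact: cvg_cst.
  apply: cvgM; last exact: cvg_cst.
  apply: cvgB; first by rewrite expr2; under eq_fun do rewrite expr2;
    exact: cvgM.
  by apply: cvgM => //; exact: cvg_cst.
rewrite -(cvg_lim _ cv)//; apply: limr_ge; first by apply/cvg_ex; eexists;
  exact: cv.
by apply: nearW => n; exact: nubar_le.
Qed.

Lemma SbarP x t y : 0 <= t -> Sbar rho0 x t y <->
  forall e, 0 < e -> exists2 z, `|z - y| < e & F x t z < nu x t + e.
Proof.
move=> t0; split.
  move=> [u [uy Fu]] e e0.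
  have /filter_ex[n [h1 h2]] : \forall n \near \oo,
      `|u n - y| < e /\ F x t (u n) < nu x t + e.
    near=> n; split; near: n.
      by move/cvgrPdist_lt : uy => /(_ _ e0); apply: filterS => n;
        rewrite distrC.
    by apply: (cvgr_lt _ Fu); rewrite ltrDl.
  by exists (u n).
move=> H; have H' n : exists z, `|z - y| < n.+1%:R^-1 /\ F x t z < nu x t +
  n.+1%:R^-1.
  have n0 : 0 < n.+1%:R^-1 :> R by rewrite invr_gt0.
  by have [z ? ?] := H _ n0; exists z.
have /choice[u hu] := H'; exists u.
have inv0 : n.+1%:R^-1 @[n --> \oo] --> (0 : R) by exact: cvg_harmonic.
have near_e e : 0 < e -> \forall n \near \oo, n.+1%:R^-1 < e.
  by move=> e0; apply: (cvgr_lt _ inv0).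
split; apply/cvgrPdist_lt => e /near_e; apply: filterS => n ne.
  by have [h1 _] := hu n; rewrite distrC (lt_trans h1).
have [_ h2] := hu n; rewrite distrC ger0_norm ?subr_ge0 ?nubar_le//.
by rewrite ltrBlDl (lt_trans h2)// ltrD2l.
Unshelve. all: by end_near. Qed.

Lemma sptP y : spt rho0 y <-> forall e, 0 < e -> m (y - e) < m (y + e).
Proof.
split=> [ys e e0|H U oU Uy].
  have yy : y - e <= y + e by lra.
  have := ys `]y - e, y + e[%classic (itv_open _ _).
  rewrite /= in_itv/= => /(_ ltac:(apply/andP; split; lra)) h.
  have : (0 < rho0 `[(y - e)%R, (y + e)%R[%classic)%E.
    apply: lt_le_trans h _; apply: le_measure; rewrite ?inE//.
    by move=> z /=; rewrite !in_itv/= => /andP[/ltW -> ->].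
  by rewrite measure_itvco// lte_fin subr_gt0.
move: (oU); rewrite openE => /(_ _ Uy) [e /= e0 eU].
have e20 : 0 < e / 2 by rewrite divr_gt0.
have yy : y - e / 2 <= y + e / 2 by lra.
have := H _ e20; rewrite -subr_gt0 -lte_fin -measure_itvco// => /lt_le_trans;
  apply.
apply: le_measure; rewrite ?inE//; first exact: open_measurable.
move=> z /=; rewrite in_itv/= => /andP[? ?]; apply: eU => /=.
by rewrite ltr_norml; apply/andP; split; lra.
Qed.

End potential.

(** * Existence and location of generalized minimizers *)

Section minimizer.
Context {R : realType}.
Variable rho0 : {finite_measure set (measurableTypeR R) -> \bar R}.
Hypothesis hF : Fbar_well_defined rho0.
Implicit Types x t y z a b e : R.
Local Notation M := (mass rho0).
Local Notation m := (m0 rho0).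
Local Notation F := (Fbar rho0).
Local Notation nu := (nubar rho0).

Let ndm : nondecreasing m. Proof. exact: m0_nondecreasing. Qed.

Let M0 : 0 <= M. Proof. exact: is_cdf_mass_ge0 (m0_is_cdf rho0). Qed.

(** The integrand is nonpositive left of [x - t * (M / 2)] and, in [Fge], nonnegative right of
    [x + t * (M / 2)], so near-minimizers can be moved into the compact interval between. *)
Let Fle x t a b : 0 <= t -> a <= b -> b <= x - t * (M / 2) ->
  F x t b <= F x t a.
Proof.
move=> t0 ab bx; have /andP[_ h] := FbarB_bounds hF x t0 ab.
rewrite -subr_le0 (le_trans h)//; apply: mulr_le0_ge0;
  last by rewrite subr_ge0 ndm.
lra.
Qed.

Let Fge x t a b : 0 <= t -> a <= b -> x + t * (M / 2) <= a ->
  F x t a <= F x t b.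
Proof.
move=> t0 ab bx; have /andP[h _] := FbarB_bounds hF x t0 ab.
rewrite -subr_ge0 (le_trans _ h)//; apply: mulr_ge0;
  last by rewrite subr_ge0 ndm.
lra.
Qed.

Let nu_eq x t y : 0 <= t -> (forall e, 0 < e -> F x t y < nu x t + e) ->
  F x t y = nu x t.
Proof.
move=> t0 h; apply/le_anti; rewrite nubar_le// andbT.
by apply/ler_addgt0Pr => e e0; exact/ltW/h.
Qed.

Lemma Sbar_minimizer x t y : 0 <= t -> F x t y = nu x t -> Sbar rho0 x t y.
Proof.
move=> t0 Fy; apply/(SbarP hF) => // e e0; exists y;
  first by rewrite subrr normr0.
by rewrite Fy ltrDl.
Qed.

Lemma Sbar_nonempty x t : 0 <= t -> exists y, Sbar rho0 x t y.
Proof.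
move=> t0; have K0 : 0 <= t * (M / 2) by rewrite mulr_ge0// divr_ge0.
pose A := x - t * (M / 2); pose B := x + t * (M / 2).
have AB : A <= B by rewrite /A /B; lra.
have H n : exists z, [/\ A <= z, z <= B & F x t z < nu x t + n.+1%:R^-1].
  have n0 : 0 < n.+1%:R^-1 :> R by rewrite invr_gt0.
  have [z Fz] := nubar_adherent hF x t0 n0.
  have [zA|Az] := ltP z A.
    exists A; split => //; apply: le_lt_trans Fz.
    exact: Fle (ltW zA) (lexx _).
  have [Bz|zB] := ltP B z.
    exists B; split => //; apply: le_lt_trans Fz.
    exact: Fge (ltW Bz) (lexx _).
  by exists z.
have /choice[u hu] := H.
have [|f incf /cvg_ex[y uy]] := bolzano_weierstrass (u_ := u).
  exists (`|A| + `|B|); split; first exact: num_real.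
  move=> C hC n _ /=; have [h1 h2 _] := hu n; apply: le_trans (ltW hC).
  have := ler_norm B; have := ler_norm (- A); rewrite normrN.
  have := normr_ge0 A; have := normr_ge0 B.
  by move=> *; rewrite ler_norml; apply/andP; split; lra.
(* A subsequence inherits the error bound [1/(n+1)]. *)
have fn n : (n <= f n)%N.
  elim: n => // n IH; apply: leq_ltn_trans IH _.
  by rewrite ltnNge -leEnat incf -ltnNge.
exists y, (u \o f); split => //; apply/cvgrPdist_lt => e e0.
have inv0 : n.+1%:R^-1 @[n --> \oo] --> (0 : R) by exact: cvg_harmonic.
have : \forall n \near \oo, n.+1%:R^-1 < e by apply: (cvgr_lt _ inv0).
apply: filterS => n ne; rewrite /= distrC ger0_norm ?subr_ge0 ?nubar_le//.
have [_ _ h] := hu (f n); rewrite ltrBlDl (lt_trans h)// ltrD2l.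
by apply: le_lt_trans ne; rewrite lef_pV2 ?posrE// ler_nat ltnS.
Qed.

(** Off the support [m0] is locally constant, so a point of [Sbar] there is a true minimizer, and so
    is its whole plateau. An end of the plateau lies in the support: the right end if there is mass
    beyond, otherwise the left end. *)
Lemma Sbar_spt_nonempty x t : 0 <= t -> 0 < M ->
  exists y, (Sbar rho0 x t `&` spt rho0) y.
Proof.
move=> t0 Mgt0; have [y0 Sy0] := Sbar_nonempty x t0.
have [?|] := pselect (spt rho0 y0); first by exists y0.
move=> /sptP/existsNP[d /not_implyP[d0 /negP]]; rewrite -leNgt => md.
have Fy0 : F x t y0 = nu x t.
  apply: nu_eq => // e e0.
  have de0 : 0 < Num.min d e by rewrite lt_min d0 e0.
  have [z zy Fz] := (SbarP hF _ _ t0).1 Sy0 _ de0.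
  have mE w : y0 - d <= w -> w <= y0 + d -> m w = m (y0 - d).
    move=> w1 w2; apply/le_anti/andP; split; last exact: ndm.
    exact: le_trans (ndm w2) md.
  have zE : F x t y0 = F x t z.
    move: zy; rewrite lt_min ltr_norml => /andP[/andP[? ?] _].
    by apply: Fbar_eq => //; rewrite !mE//; lra.
  by rewrite zE (lt_le_trans Fz)// lerD2l ge_min lexx orbT.
have [[z0 mz0]|allz] := pselect (exists z, m y0 < m z).
  pose A := [set z | m z <= m y0].
  have ubA : ubound A z0.
    move=> z /= mz; rewrite leNgt; apply/negP => /ltW /ndm.
    by rewrite leNgt (le_lt_trans mz).
  have sA : has_sup A by split; [exists y0; rewrite /A/=|exists z0].
  pose b := sup A.
  have yb : y0 <= b by apply: ub_le_sup; [exists z0|rewrite /A/=].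
  (* Left continuity of [m0] keeps the right end on the plateau. *)
  have mb : m b = m y0.
    apply/le_anti/andP; split; last exact: ndm.
    rewrite leNgt -(llim_m0 rho0 b); apply/negP => /(llim_gt_ex ndm)[y yb' my].
    have [z Az yz] := sup_adherent (ltac:(by rewrite subr_gt0) : 0 < b - y) sA.
    move: yz; rewrite -/b subKr => /ltW /ndm yz.
    by move: Az; rewrite /A/= leNgt (lt_le_trans my).
  exists b; split.
    by apply: Sbar_minimizer => //; rewrite -Fy0; exact: Fbar_eq.
  apply/sptP => e e0; apply: (@le_lt_trans _ _ (m b)); first by apply: ndm; lra.
  rewrite mb ltNge; apply/negP => be.
  have : b + e <= b by apply: ub_le_sup => //; exists z0.
  lra.
have mM z : y0 <= z -> m z = M.
  have [_ _ hM] := m0_is_cdf rho0.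
  have my0 : M <= m y0.
    rewrite -(cvg_lim _ hM)//; apply: limr_le; first by apply/cvg_ex; exists M.
    apply: nearW => w; rewrite leNgt; apply/negP => h; apply: allz; by exists w.
  move=> yz; apply/le_anti; rewrite m0_le_mass/=.
  exact: le_trans my0 (ndm yz).
pose A := [set z | M <= m z].
have [z1 mz1] : exists z, m z < M.
  have [_ h0 _] := m0_is_cdf rho0.
  have : \forall z \near -oo, m z < M by exact: (cvgr_lt _ h0).
  by move=> /filter_ex.
have lbA : lbound A z1.
  move=> z /= mz; rewrite leNgt; apply/negP => /ltW /ndm.
  by rewrite leNgt (lt_le_trans mz1).
have iA : has_inf A by split; [exists y0; rewrite /A/= mM|exists z1].
pose a := inf A.
have mA z : a < z -> m z = M.
  move=> az; have [w Aw wz] := inf_adherent (ltac:(by rewrite subr_gt0) : 0 < z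
    - a) iA.
  apply/le_anti; rewrite m0_le_mass/= (le_trans Aw)// ndm//.
  by move: wz; rewrite -/a addrC subrK => /ltW.
exists a; split.
  (* The left end may carry an atom, and then [m a < M]; so [a] is approached from the right, where
     [F] has its plateau value. *)
  apply/(SbarP hF) => // e e0; exists (a + e / 2).
    by rewrite addrC addKr gtr0_norm; lra.
  rewrite (@Fbar_eq _ _ hF x t _ y0)// ?Fy0 ?ltrDl//.
  by rewrite (mM y0 (lexx _)) mA//; lra.
apply/sptP => e e0; rewrite (mA (a + e)); last by lra.
rewrite ltNge; apply/negP => h.
have : a <= a - e by apply: ge_inf => //; exists z1.
lra.
Qed.

(** Either [A] is a lower bound, or some [y1] of the set lies left of [A] and is itself one: a point
    of [Sbar] further left would make [F] constant around [y1], while [F] strictly decreases across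
    a support point left of [A]. *)
Lemma Sbar_spt_lbound x t : 0 <= t -> has_lbound (Sbar rho0 x t `&` spt rho0).
Proof.
move=> t0; pose A := x - t * (M / 2).
have [[y1 [[Sy1 sy1] y1A]]|all] :=
    pselect (exists y1, (Sbar rho0 x t `&` spt rho0) y1 /\ y1 < A); last first.
  exists A => y Sy; rewrite leNgt; apply/negP => yA; apply: all; by exists y.
exists y1 => y [Sy sy]; rewrite leNgt; apply/negP => yy1.
have FE w : y < w -> w <= A -> F x t w = nu x t.
  move=> yw wA; apply: nu_eq => // e e0.
  have d0 : 0 < Num.min e (w - y) by rewrite lt_min e0 subr_gt0.
  have [z zy Fz] := (SbarP hF _ _ t0).1 Sy _ d0.
  move: zy; rewrite lt_min => /andP[_]; rewrite ltr_norml => /andP[_ zw].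
  have zw' : z <= w by lra.
  rewrite (le_lt_trans (Fle t0 zw' wA))// (lt_le_trans Fz)//.
  by rewrite lerD2l ge_min lexx.
(* Halving keeps [y1 - d] right of [y] and [y1 + d] strictly left of [A], where the integrand is
   negative. *)
pose d := Num.min (y1 - y) (A - y1) / 2.
have d0 : 0 < d by rewrite divr_gt0// lt_min !subr_gt0 yy1.
have dy : d * 2 <= y1 - y by rewrite divfK// ge_min lexx.
have dA : d * 2 <= A - y1 by rewrite divfK// ge_min lexx orbT.
have := (sptP rho0 y1).1 sy1 d d0; rewrite -subr_gt0 => mm.
have dd : y1 - d <= y1 + d by lra.
have /andP[_] := FbarB_bounds hF x t0 dd.
have F1 : F x t (y1 - d) = nu x t by apply: FE; lra.
have F2 : F x t (y1 + d) = nu x t by apply: FE; lra.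
rewrite F1 F2 subrr leNgt => /negP; apply; rewrite pmulr_llt0//.
by move: dA; rewrite /A; lra.
Qed.

(** [Sbar] is closed, by splitting [e] in halves, and thus contains the infimum of its subset. *)
Lemma Sbar_ystar x t : 0 <= t -> 0 < M -> Sbar rho0 x t (ystar rho0 x t).
Proof.
move=> t0 Mgt0; pose S := Sbar rho0 x t `&` spt rho0.
have iS : has_inf S.
  by split; [exact: Sbar_spt_nonempty|exact: Sbar_spt_lbound].
apply/(SbarP hF) => // e e0; have e20 : 0 < e / 2 by rewrite divr_gt0.
have [s [Ss ss] sy] := inf_adherent e20 iS.
have ys : ystar rho0 x t <= s by apply: ge_inf; [case: iS|split].
have [z zs Fz] := (SbarP hF _ _ t0).1 Ss _ e20.
exists z; last by rewrite (lt_trans Fz)// ltrD2l; lra.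
rewrite -/(ystar rho0 x t) in sy.
by move: zs; rewrite !ltr_norml => /andP[? ?]; apply/andP; split; lra.
Qed.

(** If [ystar] is a minimizer, the constant sequence works. Otherwise [Fbar] is left-continuous
    there, so a minimizing sequence tending to [ystar] must eventually lie to its right, and [m0]
    tends to the closed half-line mass of the second branch. *)
Lemma mbar_minimizing x t : 0 <= t -> exists u : nat -> R,
  F x t (u n) @[n --> \oo] --> nu x t /\ m (u n) @[n --> \oo] --> mbar rho0 x t.
Proof.
move=> t0; rewrite /mbar; set y := ystar rho0 x t.
case: eqVneq => [->|Fy].
  by exists (fun=> y); split; exact: cvg_cst.
(* Without mass [F] is constant and every point is a minimizer, contrary to [Fy]. *)
have Mgt0 : 0 < M.
  rewrite lt_neqAle M0 andbT; apply: contra Fy => /eqP M00.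
  have mz z : m z = 0.
    by apply/le_anti; rewrite m0_ge0 andbT (le_trans (m0_le_mass rho0 z)) -?M00.
  apply/eqP/esym/nu_eq => // e e0; have [z] := nubar_adherent hF x t0 e0.
  by rewrite (@Fbar_eq _ _ hF x t y z)// !mz.
have [u [uy Fu]] := Sbar_ystar x t0 Mgt0.
have y1 : y - 1 < y by lra.
(* [K] dominates both factors of [FbarB_bounds] on [[y - 1, y]]; [e] below is half the gap between
   [F x t y] and the infimum. *)
pose K := `|(y - 1) - x - t * (M / 2)| + `|y - x + t * (M / 2)| + 1.
have K0 : 0 < K by rewrite ltr_wpDl// addr_ge0.
pose e := `|F x t y - nu x t| / 2.
have e0 : 0 < e by rewrite divr_gt0// normr_gt0 subr_eq0 eq_sym.
have [z0 z0y mz0] : exists2 z, z < y & m y - e / K < m z.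
  by apply: (llim_gt_ex ndm); rewrite llim_m0 ltrBlDr ltrDl divr_gt0.
have Fleft z : Num.max z0 (y - 1) < z -> z <= y -> `|F x t z - F x t y| < e.
  rewrite gt_max => /andP[zz0 zy1] zy.
  have /andP[h1 h2] := FbarB_bounds hF x t0 zy.
  have dm : m y - m z < e / K by have := ndm (ltW zz0); lra.
  have dm0 : 0 <= m y - m z by rewrite subr_ge0 ndm.
  have dK : (m y - m z) * K < e by rewrite -ltr_pdivlMr.
  apply: le_lt_trans dK; rewrite distrC ler_norml; apply/andP; split.
    apply: le_trans h1; rewrite -mulrN mulrC -subr_ge0 -mulrBl mulr_ge0//.
    have := ler_norm (- (y - 1 - x - t * (M / 2))); rewrite normrN /K.
    have := normr_ge0 (y - x + t * (M / 2)); lra.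
  apply: le_trans h2 _; rewrite mulrC ler_wpM2l//.
  have := ler_norm (y - x + t * (M / 2)); rewrite /K.
  have := normr_ge0 (y - 1 - x - t * (M / 2)); lra.
have [N _ hN] : \forall n \near \oo, y < u n.
  have l1 : \forall n \near \oo, Num.max z0 (y - 1) < u n.
    by apply: (cvgr_gt _ uy); rewrite gt_max z0y.
  have l2 : \forall n \near \oo, `|nu x t - F x t (u n)| < e.
    by move/cvgrPdist_lt : Fu; exact.
  near=> n; rewrite ltNge; apply/negP => uny.
  have h1 : `|F x t (u n) - F x t y| < e by apply: Fleft => //; near: n.
  have h2 : `|nu x t - F x t (u n)| < e by near: n.
  have : `|F x t y - nu x t| < e + e.
    rewrite distrC (le_lt_trans (ler_distD (F x t (u n)) _ _))//.
    exact: ltrD.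
  by rewrite /e -splitr ltxx.
exists (fun n => u (n + N)%N); split;
  first by rewrite (cvg_shiftn N (F x t \o u)).
rewrite -rlim_m0.
have /cvg_at_rightP : m z @[z --> y^'+] --> rlim m y.
  exact: nondecreasing_is_cvg_right.
apply; split; last by rewrite (cvg_shiftn N).
by move=> n; apply: hN => /=; exact: leq_addl.
Unshelve. all: by end_near. Qed.

(* The initial datum is attached at t = 0 (and, as a junk value, at t < 0). *)
Definition mext x t : R := if 0 < t then mbar rho0 x t else m x.

(** At t = 0 the integrand is [eta - x], which changes sign at [x]; so [x] is a minimizer and [m0 x]
    the corresponding value. *)
Lemma mext_minimizing x t : 0 <= t -> exists u : nat -> R,
  F x t (u n) @[n --> \oo] --> nu x t /\ m (u n) @[n --> \oo] --> mext x t.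
Proof.
rewrite /mext le_eqVlt => /predU1P[<-|t0]; last first.
  by rewrite t0; apply: mbar_minimizing; exact: ltW.
rewrite ltxx; exists (fun=> x); split; last exact: cvg_cst.
have -> : nu x 0 = F x 0 x; last exact: cvg_cst.
apply/esym/nu_eq => // e e0; have [y Fy] := nubar_adherent hF x (lexx 0) e0.
apply: le_lt_trans Fy; have [xy|/ltW yx] := leP x y.
  by apply: Fge => //; rewrite mul0r addr0.
by apply: Fle => //; rewrite mul0r subr0.
Qed.

Lemma mext_supergradient x t x' t' : 0 <= t -> 0 <= t' ->
  nu x' t' <= nu x t - (x' - x) * mext x t - (t' - t) * flux M (mext x t).
Proof.
move=> t0 t'0; have [u [Fu mu]] := mext_minimizing x t0.
exact: nubar_supergradient Fu mu.
Qed.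

Lemma mext_ge0 x t : 0 <= mext x t.
Proof.
rewrite /mext; case: ifP => _; last exact: m0_ge0.
by rewrite /mbar; case: ifP => _; rewrite fine_ge0.
Qed.

Lemma mext_le x t : mext x t <= M.
Proof.
have le (A : set R) : measurable A -> fine (rho0 A) <= M.
  by move=> mA; rewrite fine_le ?fin_num_measure// le_measure ?inE.
rewrite /mext; case: ifP => _; last exact: m0_le_mass.
by rewrite /mbar; case: ifP => _; apply: le; exact: measurable_itv.
Qed.

Lemma mext0 : mext ^~ 0 = m.
Proof. by apply/funext => x; rewrite /mext ltxx. Qed.

Lemma mextE t : 0 < t -> mext ^~ t = mbar rho0 ^~ t.
Proof. by move=> t0; apply/funext => x; rewrite /mext t0. Qed.

End minimizer.

Theorem theorem2p6 (R : realType)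
    (rho0 : {finite_measure set (measurableTypeR R) -> \bar R})
    (hF : Fbar_well_defined rho0) :
  weak_solution rho0 (mbar rho0).
Proof.
have m_ge0 x t : 0 <= t -> 0 <= mext rho0 x t by move=> _; exact: mext_ge0.
have m_le x t : 0 <= t -> mext rho0 x t <= mass rho0.
  by move=> _; exact: mext_le.
have sg := mext_supergradient hF.
have m_init : is_cdf (mass rho0) (mext rho0 ^~ 0).
  by rewrite mext0; exact: m0_is_cdf.
have mE t : 0 < t -> mbar rho0 ^~ t = mext rho0 ^~ t.
  by move=> t0; exact/esym/mextE.
split.
- by move=> x t t0; have := mext_ge0 rho0 x t; have := mext_le rho0 x t;
    rewrite /mext t0 => -> ->.
- move=> t t0; rewrite -mextE//.
  exact: supergradient_nondecreasing m_ge0 m_le sg _ (ltW t0).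
- exact: (supergradient_weak_cvg_nbhs m_ge0 m_le sg m_init mE).
- move=> phi tphi.
  have [c [d [a [b [cd a0 ab box]]]]] := test_function_box tphi.
  apply: (weak_formulation_box m_ge0 m_le sg m_init tphi cd a0 ab box).
    by move=> t t0; rewrite /transport_term /mext t0.
  by move=> t t0; rewrite /drift_term (mE t t0).
(* The slice at t = 0 is [m0], whose Stieltjes measure is [rho0]. *)
- move=> psi cpsi bpsi.
  have -> : \int[rho0]_x psi x = \int[stieltjes (mext rho0 ^~ 0)]_x psi x.
    rewrite /Rintegral; congr fine; apply: eq_measure_integral => A mA _.
    by rewrite mext0 stieltjes_m0.
  exact: (supergradient_weak_cvg_at_right m_ge0 m_le sg m_init mE cpsi bpsi).
Qed.
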